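(* Let $\epsilon\in\{0,1\}$, let $(\mathcal{A},\cdot)$ be an associative (not necessarily commutative) graded algebra of suspension parity $\epsilon$, let $e\in\mathcal{A}$ be an element of Grassmann parity $\epsilon(e)=\epsilon$, and let $\Delta:\mathcal{A}\to\mathcal{A}$ be a Grassmann-odd linear operator. Let $R_e:\mathcal{A}\to\mathcal{A}$, $R_e(b)=b\cdot e$. Then the Koszul $\bullet$-bracket $\Phi_\Delta$ satisfies the square identity $$\Phi_\Delta\circ\Phi_\Delta=\Phi_{\Delta R_e\Delta},$$ where $\circ$ is the ordinary bracket product, i.e. for all $n\ge 0$ and all homogeneous $a_1,\dots,a_n\in\mathcal{A}$, $$\sum_{k=0}^{n}\frac{1}{k!(n-k)!}\sum_{\pi\in S_n}(-1)^{\epsilon_{\pi,a}}\,\Phi_\Delta^{n-k+1}\big(\Phi_\Delta^{k}(a_{\pi(1)},\dots,a_{\pi(k)}),a_{\pi(k+1)},\dots,a_{\pi(n)}\big)=\Phi^n_{\Delta R_e\Delta}(a_1,\dots,a_n).$$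
   Context: Vector spaces are $\mathbb{Z}_2$-graded over $\mathbb{C}$; $\epsilon_a=\epsilon(a)$ is the Grassmann parity (mod 2) of a homogeneous element $a$. A graded algebra $(\mathcal{A},\cdot)$ of suspension parity $\epsilon$ is a graded vector space with a bilinear, associative product ($(a\cdot b)\cdot c=a\cdot(b\cdot c)$) with $\epsilon(a\cdot b)=\epsilon_a+\epsilon_b+\epsilon$. No unit is assumed. Sign $(-1)^{\epsilon_{\pi,a}}$: let $\mathrm{Sym}^n_\epsilon\mathcal{A}$ be the quotient of $\mathcal{A}^{\otimes n}$ in which neighbouring factors commute as $b\odot a=(-1)^{(\epsilon_a+\epsilon)(\epsilon_b+\epsilon)}a\odot b$. Then $(-1)^{\epsilon_{\pi,a}}$ is the sign defined by $a_{\pi(1)}\odot\dots\odot a_{\pi(n)}=(-1)^{\epsilon_{\pi,a}}a_1\odot\dots\odot a_n$, obtained by applying this rule to each transposition of neighbours. Koszul brackets (general non-commutative case): define numbers $B_{k,\ell}$ by the generating function $$\sum_{k,\ell\ge0}B_{k,\ell}\frac{x^k}{k!}\frac{y^\ell}{\ell!}=\frac{x-y}{e^x-e^y}.$$ For a linear operator $T:\mathcal{A}\to\mathcal{A}$ of Grassmann parity $\epsilon_T$, the Koszul $\bullet$-bracket $\Phi_T=(\Phi_T^n)_{n\ge0}$ is $$\Phi_T^n(a_1,\dots,a_n)=\sum_{\substack{i,j,k\ge0\\ i+j+k=n}}\frac{B_{i,k}}{i!\,j!\,k!}\sum_{\pi\in S_n}(-1)^{\epsilon_{\pi,a}+\epsilon_T(\epsilon_{\pi(1)}+\dots+\epsilon_{\pi(i)}+i\epsilon)}\,a_{\pi(1)}\cdot\ldots\cdot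 a_{\pi(i)}\cdot T\big(a_{\pi(i+1)}\cdot\ldots\cdot a_{\pi(i+j)}\cdot e\big)\cdot a_{\pi(i+j+1)}\cdot\ldots\cdot a_{\pi(n)},$$ where $\epsilon_{r}$ denotes $\epsilon(a_r)$ and empty products of $a$'s are omitted; in particular $\Phi_T^0=T(e)$. Here $\Delta$ is odd, and $\Delta R_e\Delta$ is even. *)

(* Defs.v *)
From HB Require Import structures.
From mathcomp Require Import all_boot all_order all_fingroup all_algebra.
From mathcomp Require Export sesquilinear reals complex.

Set Implicit Arguments.
Unset Strict Implicit.
Unset Printing Implicit Defensive.

Import GRing.Theory Num.Theory.
Local Open Scope ring_scope.

(* Formal power series in x and y, f m n being the coefficient of x^m y^n. *)
Section KoszulNumbers.
Variable F : numFieldType.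
Implicit Types f g B c : nat -> nat -> F.

Definition series2_mul f g : nat -> nat -> F := fun m n =>
  \sum_(i < m.+1) \sum_(j < n.+1) f i j * g (m - i)%N (n - j)%N.
Definition series2_sub f g : nat -> nat -> F := fun m n => f m n - g m n.
Definition varx : nat -> nat -> F := fun m n => ((m == 1%N) && (n == 0%N))%:R.
Definition vary : nat -> nat -> F := fun m n => ((m == 0%N) && (n == 1%N))%:R.
Definition expx : nat -> nat -> F := fun m n => (n == 0%N)%:R / (m`!)%:R.
Definition expy : nat -> nat -> F := fun m n => (m == 0%N)%:R / (n`!)%:R.
Definition egf2 B : nat -> nat -> F := fun k l => B k l / (k`! * l`!)%:R.

(* sum_(k, l) B_(k, l) x^k/k! y^l/l! = (x - y) / (e^x - e^y), with the
   denominator cleared: e^x - e^y is not invertible as a power series, but it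
   is a non-zero-divisor, so this determines B (koszul_number_unique). *)
Definition koszul_number_spec B : Prop :=
  forall m n, series2_mul (egf2 B) (series2_sub expx expy) m n
              = series2_sub varx vary m n.

Local Definition quo m n : F := ((m + n).+1)`!%:R^-1.

Fact nat_neq0 n : (0 < n)%N -> (n%:R : F) != 0.
Proof. by rewrite pnatr_eq0 -lt0n. Qed.

Fact fact_neq0 n : ((n`!)%:R : F) != 0.
Proof. by rewrite nat_neq0 // fact_gt0. Qed.

Fact expdiffE m n : series2_sub expx expy m n =
  (if m is m'.+1 then quo m' n else 0) - (if n is n'.+1 then quo m n' else 0).
Proof.
rewrite /series2_sub /expx /expy /quo; case: m n => [|m] [|n] /=.
- by rewrite fact0 subrr subr0.
- by rewrite mul0r mul1r add0n.
- by rewrite mul0r mul1r addn0.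
- by rewrite !mul0r addSn addnS !subrr.
Qed.

Fact mul_expdiffE c m n : series2_mul c (series2_sub expx expy) m n =
  (if m is m'.+1 then series2_mul c quo m' n else 0)
  - (if n is n'.+1 then series2_mul c quo m n' else 0).
Proof.
rewrite /series2_mul.
under eq_bigr => i _ do under eq_bigr => j _ do rewrite expdiffE mulrBr.
under eq_bigr => i _ do rewrite sumrB.
rewrite sumrB; congr (_ - _).
- case: m => [|m].
    by rewrite big_ord_recr big_ord0 /= add0r big1 // => j _; rewrite mulr0.
  rewrite big_ord_recr /= [X in _ + X]big1 ?addr0 => [|j _]; last first.
    by rewrite subnn mulr0.
  by apply: eq_bigr => i _; apply: eq_bigr => j _; rewrite subSn // -ltnS.
- apply/esym; case: n => [|n].
    apply/esym; apply: big1 => i _.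
    by rewrite big_ord_recr big_ord0 /= add0r mulr0.
  apply: eq_bigr => i _; rewrite [RHS]big_ord_recr /= subnn mulr0 addr0.
  by apply: eq_bigr => j _; rewrite subSn // -ltnS.
Qed.

Fact mul_quoE c :
  (forall m n, series2_mul c (series2_sub expx expy) m n
               = series2_sub varx vary m n) <->
  (forall m n, series2_mul c quo m n = ((m == 0%N) && (n == 0%N))%:R).
Proof.
split=> [cP m n | cP m n]; last first.
  rewrite mul_expdiffE /series2_sub /varx /vary.
  by case: m n => [|m] [|n]; rewrite ?cP ?eqSS ?andbF ?subr0.
elim: n m => [|n IHn] m; have := cP m.+1.
  move/(_ 0%N); rewrite mul_expdiffE /series2_sub /varx /vary /=.
  by rewrite !subr0 eqSS.
move/(_ n.+1); rewrite mul_expdiffE IHn /series2_sub /varx /vary /=.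
by rewrite andbF !subr0.
Qed.

Local Definition others m n c := \sum_(i < m.+1) \sum_(j < n.+1 | (i != m :> nat) || (j != n :> nat))
  c i j * quo (m - i) (n - j).

Fact mul_quo_recr c m n : series2_mul c quo m n = c m n + others m n c.
Proof.
rewrite /others !big_ord_recr /= addrCA /series2_mul big_ord_recr /=; congr (_ + _).
  apply: eq_bigr => i _; apply: eq_bigl => j.
  by rewrite neq_ltn ltn_ord.
rewrite big_ord_recr big_mkcond [in RHS]big_mkcond big_ord_recr /= !eqxx /= addr0.
have quo00 : quo 0 0 = 1 := invr1 F.
rewrite addrC !subnn quo00 mulr1; congr (_ + _).
by apply: eq_bigr => j _; rewrite neq_ltn ltn_ord.
Qed.

Fact eq_others m n c c' :
  (forall i j, (i + j < m + n)%N -> c i j = c' i j) -> others m n c = others m n c'.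
Proof.
move=> cc'; apply: eq_bigr => i _; apply: eq_bigr => j ne; congr (_ * _).
apply: cc'; have := ltn_ord i; have := ltn_ord j; rewrite !ltnS => lej lei.
case/orP: ne => ne; first by rewrite -addSn leq_add // ltn_neqAle ne.
by rewrite -addnS leq_add // ltn_neqAle ne.
Qed.

Local Fixpoint approx (N m n : nat) : F :=
  if N is N'.+1 then ((m == 0%N) && (n == 0%N))%:R - others m n (approx N') else 0.

Fact approx_stable N N' m n :
  (m + n < N)%N -> (m + n < N')%N -> approx N m n = approx N' m n.
Proof.
elim: N N' m n => [|N IHN] [|N'] m n //= leN leN'; congr (_ - _).
by apply: eq_others => i j lt; apply: IHN; apply: leq_trans lt _.
Qed.

Fact egf2K c k l : egf2 (fun i j => c i j * (i`! * j`!)%:R) k l = c k l.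
Proof. by rewrite /egf2 mulfK // nat_neq0 // muln_gt0 !fact_gt0. Qed.

Fact koszul_number_subproof : {B : nat -> nat -> F | koszul_number_spec B}.
Proof.
pose c m n := approx (m + n).+1 m n.
exists (fun k l => c k l * (k`! * l`!)%:R) => m n.
transitivity (series2_mul c (series2_sub expx expy) m n).
  by apply: eq_bigr => i _; apply: eq_bigr => j _; rewrite egf2K.
apply: (iffRL (mul_quoE c)) => {m n} // m n.
have cE : c m n = ((m == 0%N) && (n == 0%N))%:R - others m n c.
  rewrite {1}/c /=; congr (_ - _); apply: eq_others => i j lt.
  exact: approx_stable.
by rewrite mul_quo_recr cE subrK.
Qed.

Definition koszul_number : nat -> nat -> F := sval koszul_number_subproof.

Lemma koszul_numberP : koszul_number_spec koszul_number.
Proof. exact: svalP. Qed.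

Lemma koszul_number_unique B :
  koszul_number_spec B -> forall k l, B k l = koszul_number k l.
Proof.
move=> /mul_quoE BP k l; have /mul_quoE KP := koszul_numberP.
suff eqc N k' l' : (k' + l' < N)%N -> egf2 B k' l' = egf2 koszul_number k' l'.
  have := eqc _ k l (ltnSn _); rewrite /egf2 => /mulIf; apply.
  by rewrite invr_eq0 nat_neq0 // muln_gt0 !fact_gt0.
elim: N k' l' => // N IHN m n leN.
have := BP m n; rewrite -(KP m n) !mul_quo_recr.
rewrite (@eq_others _ _ _ (egf2 koszul_number)) => [/addIr //|i j lt].
by apply: IHN; apply: leq_trans lt _.
Qed.

End KoszulNumbers.

(* Z_2 is represented by bool (0 = false, 1 = true), addition being (+). *)
Record gradedAlgebra (F : fieldType) (eps : bool) := GradedAlgebra {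
  gcarrier :> lmodType F;
  gpart : bool -> {pred gcarrier};
  gpart_submod : forall p, submod_closed (gpart p);
  gpart_full : forall x, exists x0 x1,
    [/\ x0 \in gpart false, x1 \in gpart true & x = x0 + x1];
  gpart_direct : forall x, x \in gpart false -> x \in gpart true -> x = 0;
  gmul : {bilinear gcarrier -> gcarrier -> gcarrier};
  gmulA : associative gmul;
  gmul_parity : forall p q x y, x \in gpart p -> y \in gpart q ->
    gmul x y \in gpart (p (+) q (+) eps)
}.

Arguments gpart {F eps} _ _.
Arguments gmul {F eps} _.

Section KoszulBrackets.
Variables (F : numFieldType) (eps : bool) (A : gradedAlgebra F eps).

Definition homogeneous (x : A) : Prop := exists p, x \in gpart A p.

(* Meaningful for homogeneous x only; 0 is homogeneous of both parities, but
   its parity is immaterial since every term containing it vanishes. *)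
Definition parity (x : A) : bool := x \in gpart A true.

Definition operator_parity (T : A -> A) (epsT : bool) : Prop :=
  forall p x, x \in gpart A p -> T x \in gpart A (p (+) epsT).

Definition rmul (e : A) : A -> A := fun b => gmul A b e.

Definition permuted n (a : n.-tuple A) (pi : 'S_n) : n.-tuple A :=
  [tuple tnth a (pi r) | r < n].

(* sg pi is the exponent (mod 2) of the sign relating
   a_(pi 1) (.) ... (.) a_(pi n) to a_1 (.) ... (.) a_n.  Since
   (s * t) r = t (s r), permuted a (tperm r r' * pi) is permuted a pi with the
   factors in positions r and r' exchanged. *)
Definition koszul_sign_spec n (a : n.-tuple A) (sg : 'S_n -> bool) : Prop :=
  sg 1%g = false /\
  forall (pi : 'S_n) (r r' : 'I_n), r' = r.+1 :> nat ->
    sg (tperm r r' * pi)%g =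
    ((parity (tnth a (pi r)) (+) eps) && (parity (tnth a (pi r')) (+) eps))
    (+) sg pi.

Local Definition inv_sign n (a : n.-tuple A) (pi : 'S_n) : bool :=
  \big[addb/false]_(i < n) \big[addb/false]_(j < n | (i < j)%N && (pi j < pi i)%N)
    ((parity (tnth a (pi i)) (+) eps) && (parity (tnth a (pi j)) (+) eps)).

Fact inv_signP n (a : n.-tuple A) : koszul_sign_spec a (inv_sign a).
Proof.
split=> [|pi r r' rr'].
  rewrite /inv_sign big1 // => i _; apply: big_pred0 => j; rewrite !perm1.
  by case: ltngtP.
pose f (i j : 'I_n) := (pi j < pi i)%N &&
  ((parity (tnth a (pi i)) (+) eps) && (parity (tnth a (pi j)) (+) eps)).
have invE (s : 'S_n) : \big[addb/false]_(i < n) \big[addb/false]_(j < n |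
    (s i < s j)%N) f i j = inv_sign a (s^-1 * pi)%g.
  rewrite /inv_sign (reindex_inj (@perm_inj _ s^-1)) /=; apply: eq_bigr => i _.
  rewrite (reindex_inj (@perm_inj _ s^-1)) /= [RHS]big_mkcond [LHS]big_mkcond /=.
  apply: eq_bigr => j _; rewrite !permKV !permM /f.
  by case: ifP => //= _; case: ifP.
have neq : r != r' by rewrite -val_eqE /= rr' neq_ltn ltnSn.
have := invE (tperm r r'); rewrite tpermV => <-.
have := invE 1%g; rewrite invg1 mul1g => <-.
set S1 := (X in X = _); set S2 := (X in _ = _ (+) X).
suff E : S1 (+) S2 = f r r' (+) f r' r.
  have -> : S1 = (f r r' (+) f r' r) (+) S2 by rewrite -E -addbA addbb addbF.
  congr (_ (+) _); rewrite /f [X in _ (+) (_ && X)]andbC.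
  case: ltngtP => [_|_|/val_inj/perm_inj/eqP]; rewrite ?addbF //.
  by rewrite eq_sym (negbTE neq).
rewrite /S1 /S2 -big_split /=.
have step i : (\big[addb/false]_(j < n | (tperm r r' i < tperm r r' j)%N) f i j)
    (+) (\big[addb/false]_(j < n | ((1%g : 'S_n) i < (1%g : 'S_n) j)%N) f i j) =
  \big[addb/false]_(j < n) (((i == r) && (j == r') || (i == r') && (j == r)) && f i j).
  rewrite big_mkcond [X in _ (+) X]big_mkcond -big_split /=; apply: eq_bigr => j _.
  rewrite !perm1; case: (f i j); last by rewrite andbF !if_same.
  rewrite andbT.
  have nat_ne (k : 'I_n) : k != r -> k != r' -> (k != r :> nat) /\ (k != r' :> nat).
    by rewrite -!val_eqE.
  have r_lt_r' : (r < r')%N by rewrite rr'.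
  have ltr (k : 'I_n) : k != r -> k != r' -> (r < k)%N = (r' < k)%N.
    by move=> /nat_ne/[apply]-[k1 k2]; rewrite rr' [in RHS]ltn_neqAle -rr' eq_sym k2 rr'.
  have ltl (k : 'I_n) : k != r -> k != r' -> (k < r)%N = (k < r')%N.
    by move=> /nat_ne/[apply]-[k1 k2]; rewrite rr' ltnS [in RHS]leq_eqVlt (negbTE k1).
  have r'r : (r' < r)%N = false by apply/negbTE; rewrite -leqNgt ltnW.
  case: (tpermP r r' i) => [->|->|/eqP i1 /eqP i2]; case: (tpermP r r' j) => [->|->|/eqP j1 /eqP j2];
   rewrite ?eqxx ?(negbTE neq) ?[r' == r]eq_sym ?(negbTE neq) ?r'r ?r_lt_r' ?ltnn //=
     ?(negbTE i1) ?(negbTE i2) ?(negbTE j1) ?(negbTE j2) /= ?andbF ?orbF //;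
   rewrite ?(ltr _ j1 j2) ?(ltl _ i1 i2); by case: ifP.
under eq_bigr => i _ do rewrite step.
rewrite (bigD1 r) //= [X in _ (+) X](bigD1 r') 1?eq_sym //=.
rewrite addbA [X in _ (+) X]big1 ?addbF => [|i /andP[/negbTE i1 /negbTE i2]]; last first.
  by rewrite big1 // => j _; rewrite i1 i2.
congr (_ (+) _).
  rewrite (bigD1 r') //= !eqxx /= big1 ?addbF // => j /negbTE j1.
  by rewrite j1 [r' == r]eq_sym (negbTE neq).
rewrite (bigD1 r) //= !eqxx /= orbT big1 ?addbF // => j /negbTE j1.
by rewrite j1 [r' == r]eq_sym (negbTE neq).
Qed.

Fact koszul_sign_uniq n (a : n.-tuple A) (sg sg' : 'S_n -> bool) :
  koszul_sign_spec a sg -> koszul_sign_spec a sg' -> sg =1 sg'.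
Proof.
move=> [sg1 sgM] [sg'1 sg'M]; pose d pi := sg pi (+) sg' pi.
have dadj (r r' : 'I_n) pi : r' = r.+1 :> nat -> d (tperm r r' * pi)%g = d pi.
  by move=> rr'; rewrite /d sgM // sg'M // addbACA addbb.
have dtp m (i j : 'I_n) pi : (j = i + m :> nat)%N -> d (tperm i j * pi)%g = d pi.
  elim: m j pi => [|m IHm] j pi; first by rewrite addn0 => /val_inj ->; rewrite tperm1 mul1g.
  rewrite addnS => jE.
  have lt : (i + m < n)%N by apply: leq_trans (ltn_ord j); rewrite jE.
  pose k := Ordinal lt.
  have kj : j = k.+1 :> nat by rewrite jE.
  case: (posnP m) => [m0|m_gt0].
    by apply: dadj; rewrite kj /= m0 addn0.
  have ik : i != k by rewrite -val_eqE /= -{1}[i : nat]addn0 eqn_add2l eq_sym -lt0n.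
  have ij : i != j by rewrite -val_eqE /= jE neq_ltn ltnS leq_addr.
  have -> : tperm i j = (tperm k j * tperm i k * tperm k j)%g.
    have := tpermJ i k (tperm k j).
    by rewrite /conjg tpermV mulgA tpermL tpermD // eq_sym.
  by rewrite -!mulgA dadj // IHm // dadj.
have dtp' (i j : 'I_n) pi : d (tperm i j * pi)%g = d pi.
  case: (leqP i j) => [ij|/ltnW ji]; first by apply: (dtp (j - i)%N); rewrite subnKC.
  by rewrite tpermC; apply: (dtp (i - j)%N); rewrite subnKC.
move=> pi; suff : d pi = false by rewrite /d; case: (sg pi); case: (sg' pi).
have [ts -> _] := prod_tpermP pi.
elim: ts => [|t ts IHts]; first by rewrite big_nil /d sg1 sg'1.
by rewrite big_cons dtp'.
Qed.

Fact koszul_sign_subproof n (a : n.-tuple A) :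
  {sg : 'S_n -> bool | koszul_sign_spec a sg}.
Proof. by exists (inv_sign a); apply: inv_signP. Qed.

Definition koszul_sign n (a : n.-tuple A) : 'S_n -> bool :=
  sval (koszul_sign_subproof a).

Lemma koszul_signP n (a : n.-tuple A) : koszul_sign_spec a (koszul_sign a).
Proof. exact: svalP. Qed.

Lemma koszul_signE n (a : n.-tuple A) (pi : 'S_n) :
  koszul_sign a pi =
  \big[addb/false]_(i < n) \big[addb/false]_(j < n | (i < j)%N && (pi j < pi i)%N)
    ((parity (tnth a (pi i)) (+) eps) && (parity (tnth a (pi j)) (+) eps)).
Proof. exact: (koszul_sign_uniq (koszul_signP a) (inv_signP a)). Qed.

Definition bracket := forall n, n.-tuple A -> A.

(* With w = (a_(pi 1), ..., a_(pi n)), the summand is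
   a_(pi 1) . ... . a_(pi i)
     . T (a_(pi (i+1)) . ... . a_(pi (i+j)) . e)
     . a_(pi (i+j+1)) . ... . a_(pi n)
   with some choice of parentheses, irrelevant by associativity; booleans in
   the exponent of -1 are read as 0 or 1. *)
Definition koszul_bracket (e : A) (T : A -> A) (epsT : bool) : bracket :=
  fun n (a : n.-tuple A) =>
  \sum_(i < n.+1) \sum_(j < n.+1) \sum_(k < n.+1 | (i + j + k)%N == n)
    (koszul_number F i k / (i`! * j`! * k`!)%:R) *:
    \sum_(pi : 'S_n)
      let w := permuted a pi in
      (-1) ^+ (koszul_sign a pi
               + epsT * (\sum_(x <- take i w) parity x + i * eps))%N *:
      foldl (gmul A)
            (foldr (gmul A) (T (foldr (gmul A) e (take j (drop i w)))) (take i w))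
            (drop (i + j) w).

Definition bracket_comp (Phi Psi : bracket) : bracket :=
  fun n (a : n.-tuple A) =>
  \sum_(k < n.+1) (k`! * (n - k)`!)%:R^-1 *:
    \sum_(pi : 'S_n)
      let w := permuted a pi in
      (-1) ^+ koszul_sign a pi *:
      Phi _ [tuple of Psi _ [tuple of take k w] :: drop k w].

End KoszulBrackets.

(* Main.v *)
Require Import Defs.
From HB Require Import structures.
From mathcomp Require Import all_boot all_order all_fingroup all_algebra.
From mathcomp Require Import reals complex ring zify.

(* With the suspended parity eps(a) + eps, the sign rules are those of a Z_2-graded
   associative algebra with even product.  The bracket of T is the signed sum,
   over all orderings of its arguments, of an operation [psi] on words, and the
   square identity already holds for words, before symmetrization.

   In generating form, psi_T is the vector field B(L_a, R_a) T(exp(a) e), where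
   B(x, y) = (x - y)/(e^x - e^y) and L_a, R_a are left and right multiplication.
   Since 1/B is the symbol of the derivative of exp at a, in the coordinate exp(a)
   this vector field is the affine map T(exp(a) e), whose square is
   T R_e T (exp(a) e); the second derivatives of the change of coordinates cancel
   because T is odd.  On coefficients this cancellation is the identity [hesslE]
   for the Koszul numbers, proved by convolving with the coefficients of 1/B. *)

Set Implicit Arguments.
Unset Strict Implicit.
Unset Printing Implicit Defensive.

Import GRing.Theory Num.Theory.
Local Open Scope ring_scope.

(** * Cutting words *)

Section Cut.
Variable L : Type.
Implicit Types (u v w x y z : seq L).

(* The sum of [G u v] over all factorizations [w = u ++ v]. *)
Fixpoint cut (V : nmodType) w (G : seq L -> seq L -> V) : V :=
  if w is a :: w' then G [::] w + cut w' (fun u v => G (a :: u) v)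
  else G [::] [::].

Definition cut3 (V : nmodType) w (G : seq L -> seq L -> seq L -> V) : V :=
  cut w (fun u r => cut r (G u)).

Lemma eq_cut (V : nmodType) w (G H : seq L -> seq L -> V) :
  (forall u v, u ++ v = w -> G u v = H u v) -> cut w G = cut w H.
Proof.
elim: w G H => [|a w IHw] G H GH /=; first exact: GH.
by rewrite GH //; congr (_ + _); apply: IHw => u v uv; rewrite GH //= uv.
Qed.

Lemma eq_cut3 (V : nmodType) w (G H : seq L -> seq L -> seq L -> V) :
  (forall u v s, u ++ v ++ s = w -> G u v s = H u v s) -> cut3 w G = cut3 w H.
Proof.
move=> GH; apply: eq_cut => u r uE; apply: eq_cut => v s rE.
by rewrite GH // rE.
Qed.

Lemma cut_morph (V W : nmodType) (f : V -> W) w (G : seq L -> seq L -> V) :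
  {morph f : x y / x + y} -> f (cut w G) = cut w (fun u v => f (G u v)).
Proof. by move=> fD; elim: w G => [|a w IHw] G //=; rewrite fD IHw. Qed.

Lemma cut3_morph (V W : nmodType) (f : V -> W) w
    (G : seq L -> seq L -> seq L -> V) :
  {morph f : x y / x + y} -> f (cut3 w G) = cut3 w (fun u v s => f (G u v s)).
Proof.
move=> fD; rewrite /cut3 (cut_morph _ _ fD); apply: eq_cut => u r _.
by rewrite (cut_morph _ _ fD).
Qed.

Section CutTheory.
Variable V : nmodType.
Implicit Types G H : seq L -> seq L -> V.

Lemma cutD w G H : cut w (fun u v => G u v + H u v) = cut w G + cut w H.
Proof. by elim: w G H => [|a w IHw] G H //=; rewrite IHw addrACA. Qed.

Lemma cut3D w (G H : seq L -> seq L -> seq L -> V) :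
  cut3 w (fun u v s => G u v s + H u v s) = cut3 w G + cut3 w H.
Proof. by rewrite /cut3 -cutD; apply: eq_cut => u r _; rewrite cutD. Qed.

Lemma cut0 w G : (forall u v, u ++ v = w -> G u v = 0) -> cut w G = 0.
Proof.
elim: w G => [|a w IHw] G G0 /=; first exact: G0.
by rewrite G0 // IHw ?addr0 // => u v uv; rewrite G0 //= uv.
Qed.

Lemma cut3_0 w (G : seq L -> seq L -> seq L -> V) :
  (forall u v s, G u v s = 0) -> cut3 w G = 0.
Proof. by move=> G0; apply: cut0 => u r _; apply: cut0. Qed.

Lemma exchange_cut w w' (G : seq L -> seq L -> seq L -> seq L -> V) :
  cut w (fun u v => cut w' (fun u' v' => G u v u' v')) =
  cut w' (fun u' v' => cut w (fun u v => G u v u' v')).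
Proof. by elim: w G => [|a w IHw] G //=; rewrite IHw cutD. Qed.

Lemma cutA w (G : seq L -> seq L -> seq L -> V) :
  cut w (fun r s => cut r (fun u v => G u v s)) = cut3 w G.
Proof.
rewrite /cut3; elim: w G => [|a w IHw] G //=.
by rewrite cutD IHw addrA.
Qed.

(** The cut falls either before or after the marked letter [a]. *)
Lemma cut_cat_cons x a z G :
  cut (x ++ a :: z) G = cut x (fun u v => G u (v ++ a :: z))
                        + cut z (fun u v => G (x ++ a :: u) v).
Proof. by elim: x G => [|b x IHx] G //=; rewrite IHx addrA. Qed.

(** Both nestings run over all factorizations of [w] into five factors: the middle one of three is
    cut again, or the two outer ones are. *)
Lemma cut_regroup w (H : seq L -> seq L -> seq L -> seq L -> seq L -> V) :
  cut3 w (fun x y z => cut3 y (fun x' y' z' => H x x' y' z' z)) =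
  cut3 w (fun X y Z => cut X (fun x x' => cut Z (fun z' z => H x x' y z' z))).
Proof.
rewrite {1}/cut3.
transitivity (cut w (fun x r => cut r (fun x' r' => cut r' (fun y' Z =>
    cut Z (fun z' z => H x x' y' z' z))))).
  apply: eq_cut => x r _.
  transitivity (cut r (fun y z => cut y (fun x' q => cut q (fun y' z' => H x x' y' z' z)))) => //.
  rewrite (cutA r (fun x' q z => cut q (fun y' z' => H x x' y' z' z))).
  by apply: eq_cut => x' r' _; rewrite (cutA r' (fun y' z' z => H x x' y' z' z)).
rewrite -[LHS](cutA w (fun x x' r' => cut r' (fun y' Z =>
    cut Z (fun z' z => H x x' y' z' z)))).
apply: eq_cut => X r _; rewrite exchange_cut; apply: eq_cut => y Z _.
by [].
Qed.

(** Again two nestings of the five-factor sum: the first of three factors is cut again on one side,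
    the last on the other. *)
Lemma cut5A w (H : seq L -> seq L -> seq L -> seq L -> seq L -> V) :
  cut3 w (fun X v z => cut3 X (fun x y u => H x y u v z)) =
  cut3 w (fun x y r => cut3 r (fun u v z => H x y u v z)).
Proof.
rewrite -cutA.
transitivity (cut w (fun q z => cut q (fun x q' => cut q' (fun y q'' => cut q'' (fun u v =>
  H x y u v z))))).
  apply: eq_cut => q z _.
  rewrite (cutA q (fun x q' v => cut q' (fun y u => H x y u v z))).
  apply: eq_cut => x q' _.
  by rewrite (cutA q' (fun y u v => H x y u v z)).
rewrite (cutA w (fun x q' z => cut q' (fun y q'' => cut q'' (fun u v => H x y u v z)))).
apply: eq_cut => x r _.
rewrite (cutA r (fun y q'' z => cut q'' (fun u v => H x y u v z))).
by apply: eq_cut => y r' _; rewrite (cutA r' (fun u v z => H x y u v z)).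
Qed.

(** The summands correspond to [a] lying in the third, the second and the first factor. *)
Lemma cut3_cat_cons x a z (G : seq L -> seq L -> seq L -> V) :
  cut3 (x ++ a :: z) G =
  cut3 x (fun u v s => G u v (s ++ a :: z))
  + cut x (fun u v => cut z (fun v' s => G u (v ++ a :: v') s))
  + cut3 z (fun u v s => G (x ++ a :: u) v s).
Proof.
rewrite /cut3 cut_cat_cons -cutD; congr (_ + _).
by apply: eq_cut => u v _; rewrite cut_cat_cons.
Qed.

Lemma cut_ord w G :
  cut w G = \sum_(i < (size w).+1) G (take i w) (drop i w).
Proof.
elim: w G => [|a w IHw] G /=; first by rewrite big_ord1.
by rewrite big_ord_recl IHw.
Qed.

Lemma cut_nilr w G : (forall u v, u ++ v = w -> size v != 0%N -> G u v = 0) ->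
  cut w G = G w [::].
Proof.
elim: w G => [|a w IHw] G G0 //=.
by rewrite G0 // add0r IHw // => u v uv; apply: G0; rewrite /= uv.
Qed.

Lemma cut_nill w G : (forall u v, u ++ v = w -> size u != 0%N -> G u v = 0) ->
  cut w G = G [::] w.
Proof.
case: w => [|a w] G0 //=.
by rewrite cut0 ?addr0 // => u v uv; apply: G0; rewrite //= uv.
Qed.

End CutTheory.

(** * Convolution of coefficients indexed by pairs of words *)

Section Convolution.
Variable F : comNzRingType.
Implicit Types c d g : seq L -> seq L -> F.

(** Here [c] belongs to an outer operator and [d] to an inner one, so [d] takes the pieces next to
    the middle: the end of the left word and the beginning of the right word. For coefficients
    depending only on lengths this is the product of power series in two variables. *)
Definition conv c d : seq L -> seq L -> F := fun U S =>
  cut U (fun u u' => cut S (fun s' s => c u s * d u' s')).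

Definition delta : seq L -> seq L -> F := fun u s =>
  ((size u == 0) && (size s == 0))%N%:R.

Lemma eq_conv c c' d d' : c =2 c' -> d =2 d' -> conv c d =2 conv c' d'.
Proof.
by move=> cE dE u s; apply: eq_cut => x y _; apply: eq_cut => x' y' _; rewrite cE dE.
Qed.

Lemma cut_mull w (G : seq L -> seq L -> F) (k : F) :
  k * cut w G = cut w (fun u v => k * G u v).
Proof. by rewrite (cut_morph (f := *%R k)) // => ? ?; rewrite mulrDr. Qed.

Lemma cut_mulr w (G : seq L -> seq L -> F) (k : F) :
  cut w G * k = cut w (fun u v => G u v * k).
Proof. by rewrite (cut_morph (f := fun t => t * k)) // => ? ?; rewrite mulrDl. Qed.

Lemma conv_delta c : conv delta c =2 c.
Proof.
move=> u s; rewrite /conv cut_nill => [|x y _ /negbTE x0].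
  rewrite cut_nilr /delta /= ?mul1r // => x y _ /negbTE ->.
  by rewrite mul0r.
by apply: cut0 => x' y' _; rewrite /delta x0 mul0r.
Qed.

Lemma convA c d g : conv c (conv d g) =2 conv (conv c d) g.
Proof.
move=> U S; rewrite /conv.
transitivity (cut3 U (fun u u' u'' => cut3 S (fun s'' s' s => c u s * d u' s' * g u'' s''))).
  apply: eq_cut => u U' _.
  under eq_cut => s' s _ do rewrite cut_mull.
  rewrite exchange_cut; apply: eq_cut => u' u'' _; rewrite -cutA.
  apply: eq_cut => s' s _; rewrite cut_mull; apply: eq_cut => ? ? _.
  by rewrite mulrA.
rewrite -cutA; apply: eq_cut => u u'' _.
under [RHS]eq_cut => s' s _ do rewrite cut_mulr.
rewrite exchange_cut; apply: eq_cut => u1 u2 _; apply: eq_cut => s1 s2 _.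
by rewrite cut_mulr.
Qed.

End Convolution.
End Cut.

Arguments delta {L} F _ _.

(** * Koszul numbers and their convolution inverse *)

Section Coefficients.
Variables (L : Type) (F : numFieldType).
Implicit Types (u v w x y z s : seq L).

Definition beta : seq L -> seq L -> F := fun u s =>
  egf2 (koszul_number F) (size u) (size s).

(** The coefficients of $(e^x-e^y)/(x-y)$, the inverse of the series with coefficients [beta]. *)
Definition expdq : seq L -> seq L -> F := fun u s => (size u + size s).+1`!%:R^-1.

Lemma series2_mul_koszul m n :
  series2_mul (egf2 (koszul_number F)) (fun i j => (i + j).+1`!%:R^-1) m n
  = ((m == 0%N) && (n == 0%N))%:R.
Proof. by have /mul_quoE := koszul_numberP F; apply. Qed.

Lemma conv_beta_expdq : conv beta expdq =2 delta F.
Proof.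
move=> U S; rewrite /delta -series2_mul_koszul /series2_mul /conv.
rewrite cut_ord; apply: eq_bigr => i _.
(* In [conv] the right word is cut with the inner piece first, so the length seen by [beta] is the
   complement of the cut position. *)
rewrite cut_ord (reindex_inj rev_ord_inj) /=; apply: eq_bigr => j _.
have := ltn_ord i; have := ltn_ord j; rewrite !ltnS => jS iU.
rewrite /beta /expdq !subSS !size_drop !size_take_min subKn //.
by rewrite (minn_idPl iU) (minn_idPl (leq_subr _ _)).
Qed.

Lemma conv_expdq_beta : conv expdq beta =2 delta F.
Proof.
move=> U S; rewrite /delta -series2_mul_koszul /series2_mul /conv.
rewrite cut_ord (reindex_inj rev_ord_inj) /=; apply: eq_bigr => i _.
rewrite cut_ord; apply: eq_bigr => j _.
have := ltn_ord i; have := ltn_ord j; rewrite !ltnS => jS iU.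
rewrite /beta /expdq !subSS !size_drop !size_take_min subKn // mulrC.
by rewrite (minn_idPl jS) (minn_idPl (leq_subr _ _)).
Qed.

(* These are the coefficients of the two kinds of terms with two factors psi; only
   lengths matter, and the letter [o] accounts for the + 1 in the exponents. *)
Definition hessl (o : L) x u s := cut u (fun z p => cut s (fun q s' =>
  beta (x ++ o :: z) s' * expdq p q)).

Definition hessr (o : L) x u s := cut x (fun x' p => cut u (fun q z =>
  beta x' (z ++ o :: s) * expdq p q)).

(* Factorizations of [x ++ o :: z] with the cut after [o] are missing from the
   convolution [conv expdq beta (x ++ o :: z) _ = 0]; they give the right-hand side. *)
Lemma conv_hessl o u x s :
  conv expdq (fun x s => hessl o x u s) x s = - expdq (x ++ o :: u) s.
Proof.
rewrite /conv /hessl.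
transitivity (cut u (fun z p => cut s (fun q r =>
   cut x (fun x1 x2 => cut r (fun s' s2 =>
      expdq x1 s2 * beta (x2 ++ o :: z) s')) * expdq p q))).
  under eq_cut => x1 x2 _.
    under eq_cut => s1 s2 _ do rewrite cut_mull.
    rewrite exchange_cut.
    under eq_cut => z p _.
      under eq_cut => s1 s2 _ do rewrite cut_mull.
      rewrite (cutA s (fun q s' s2 => expdq x1 s2 * (beta (x2 ++ o :: z) s' * expdq p q))).
      over.
    over.
  rewrite exchange_cut; apply: eq_cut => z p _; rewrite exchange_cut; apply: eq_cut => q r _.
  rewrite cut_mulr; apply: eq_cut => x1 x2 _; rewrite cut_mulr; apply: eq_cut => s' s2 _.
  by rewrite mulrA.
transitivity (cut u (fun z p => cut s (fun q r => cut z (fun a b =>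
   cut r (fun s' s2 => - (expdq (x ++ o :: a) s2 * (beta b s' * expdq p q))))))).
  apply: eq_cut => z p _; apply: eq_cut => q r _.
  have := conv_expdq_beta (x ++ o :: z) r.
  rewrite /conv cut_cat_cons /delta size_cat /= addnS /= => /eqP; rewrite addr_eq0 => /eqP ->.
  rewrite mulNr cut_mulr (cut_morph (f := -%R)); last exact: opprD.
  apply: eq_cut => a b _; rewrite cut_mulr (cut_morph (f := -%R)); last exact: opprD.
  by apply: eq_cut => s' s2 _; rewrite mulrA.
(* With [a] and [s2] fixed, the sum over the other cuts is [conv beta expdq u' s''], which is
   [delta]; only [a = u] and [s2 = s] survive. *)
transitivity (cut u (fun a u' => cut s (fun s'' s2 =>
   - (expdq (x ++ o :: a) s2 * conv beta expdq u' s'')))).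
  transitivity (cut u (fun a u' => cut u' (fun b p => cut s (fun q r =>
   cut r (fun s' s2 => - (expdq (x ++ o :: a) s2 * (beta b s' * expdq p q))))))).
    rewrite -[RHS](cutA u (fun a b p => cut s (fun q r =>
   cut r (fun s' s2 => - (expdq (x ++ o :: a) s2 * (beta b s' * expdq p q)))))).
    by apply: eq_cut => z p _; rewrite exchange_cut.
  apply: eq_cut => a u' _.
  under [RHS]eq_cut => s'' s2 _.
    rewrite /conv cut_mull (cut_morph (f := -%R)); last exact: opprD.
    over.
  rewrite [RHS]exchange_cut; apply: eq_cut => b p _.
  rewrite -[LHS](cutA s (fun q s' s2 => - (expdq (x ++ o :: a) s2 * (beta b s' * expdq p q)))).
  apply: eq_cut => s'' s2 _; rewrite cut_mull (cut_morph (f := -%R)) //; exact: opprD.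
rewrite cut_nilr => [|a u' _ /negbTE u'0]; last first.
  by apply: cut0 => s'' s2 _; rewrite conv_beta_expdq /delta u'0 mulr0 oppr0.
rewrite cut_nill => [|s'' s2 _ /negbTE s''0]; last first.
  by rewrite conv_beta_expdq /delta s''0 andbF mulr0 oppr0.
by rewrite conv_beta_expdq /delta /= mulr1.
Qed.

(** Mirror image of [conv_hessl]: now [o] lies in the right argument of [beta], and the missing
    factorizations of [z ++ o :: s] are those cut before [o]. *)
Lemma conv_hessr o u x s :
  conv expdq (fun x s => hessr o x u s) x s = - expdq x (u ++ o :: s).
Proof.
rewrite /conv /hessr.
transitivity (cut x (fun X p => cut u (fun q z =>
   cut X (fun x1 x' => cut s (fun s1 s2 =>
      expdq x1 s2 * beta x' (z ++ o :: s1))) * expdq p q))).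
  rewrite -[RHS](eq_cut (G := fun X p => cut X (fun x1 x' => cut u (fun q z =>
     cut s (fun s1 s2 => expdq x1 s2 * (beta x' (z ++ o :: s1) * expdq p q)))))) => [|X p _]; last first.
    rewrite exchange_cut; apply: eq_cut => q z _; rewrite cut_mulr; apply: eq_cut => x1 x' _.
    by rewrite cut_mulr; apply: eq_cut => s1 s2 _; rewrite mulrA.
  rewrite (cutA x (fun x1 x' p => cut u (fun q z => cut s (fun s1 s2 =>
     expdq x1 s2 * (beta x' (z ++ o :: s1) * expdq p q))))).
  apply: eq_cut => x1 x2 _.
  under eq_cut => s1 s2 _ do rewrite cut_mull.
  rewrite exchange_cut; apply: eq_cut => x' p _.
  under eq_cut => s1 s2 _ do rewrite cut_mull.
  by rewrite exchange_cut.
transitivity (cut x (fun X p => cut u (fun q z => cut X (fun x1 x' => cut z (fun a b =>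
   - (expdq x1 (b ++ o :: s) * (beta x' a * expdq p q))))))).
  apply: eq_cut => X p _; apply: eq_cut => q z _.
  have := conv_expdq_beta X (z ++ o :: s).
  rewrite /conv; under eq_cut => x1 x' _ do rewrite cut_cat_cons.
  rewrite cutD /delta size_cat /= addnS /= andbF => /eqP; rewrite addrC addr_eq0 => /eqP ->.
  rewrite mulNr cut_mulr (cut_morph (f := -%R)); last exact: opprD.
  apply: eq_cut => a b _; rewrite cut_mulr (cut_morph (f := -%R)); last exact: opprD.
  by apply: eq_cut => s' s2 _; rewrite mulrA.
transitivity (cut x (fun x1 Y => cut u (fun W b =>
   - (expdq x1 (b ++ o :: s) * conv beta expdq Y W)))).
  transitivity (cut x (fun x1 Y => cut Y (fun x' p => cut u (fun q z =>
   cut z (fun a b => - (expdq x1 (b ++ o :: s) * (beta x' a * expdq p q))))))).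
    rewrite -[RHS](cutA x (fun x1 x' p => cut u (fun q z =>
   cut z (fun a b => - (expdq x1 (b ++ o :: s) * (beta x' a * expdq p q)))))).
    by apply: eq_cut => X p _; rewrite exchange_cut.
  apply: eq_cut => x1 Y _.
  under [RHS]eq_cut => W b _.
    rewrite /conv cut_mull (cut_morph (f := -%R)); last exact: opprD.
    over.
  rewrite [RHS]exchange_cut; apply: eq_cut => x' p _.
  rewrite -[LHS](cutA u (fun q a b => - (expdq x1 (b ++ o :: s) * (beta x' a * expdq p q)))).
  apply: eq_cut => W b _; rewrite cut_mull (cut_morph (f := -%R)) //; exact: opprD.
rewrite cut_nilr => [|x1 Y _ /negbTE Y0]; last first.
  by apply: cut0 => W b _; rewrite conv_beta_expdq /delta Y0 mulr0 oppr0.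
rewrite cut_nill => [|W b _ /negbTE W0]; last first.
  by rewrite conv_beta_expdq /delta W0 andbF mulr0 oppr0.
by rewrite conv_beta_expdq /delta /= mulr1.
Qed.

(** Convolution with [expdq] is injective, as [beta] inverts it, and it gives the same value on both
    sides because [expdq] depends only on the total length of its arguments. *)
Lemma hesslE o x u s : hessl o x u s = hessr o x u s.
Proof.
have conv_inj g : conv beta (conv expdq g) =2 g.
  move=> x' s'; rewrite convA -[RHS](conv_delta g).
  by apply: eq_conv => //; apply: conv_beta_expdq.
rewrite -(conv_inj (fun x s => hessl o x u s)) -[RHS](conv_inj (fun x s => hessr o x u s)).
apply: eq_conv => // x' s'; rewrite conv_hessl conv_hessr /expdq !size_cat /=.
by rewrite !(addnS, addSn) addnA.
Qed.

End Coefficients.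

(** * The square identity for words *)

Section WordIdentity.
Variables (F : numFieldType) (eps : bool) (A : gradedAlgebra F eps).
(* An element together with its suspended parity [eps(a) + eps], the latter being
   declared rather than computed so that it makes sense for non-homogeneous elements. *)
Local Notation letter := (A * bool)%type.
Implicit Types (u v w x y z s : seq letter) (c d : seq letter -> seq letter -> F).

Definition wpar w : bool := \big[addb/false]_(a <- w) a.2.
Definition wsign w : F := (-1) ^+ wpar w.

Lemma wpar_cat u v : wpar (u ++ v) = wpar u (+) wpar v.
Proof. exact: big_cat. Qed.

Lemma wpar_cons a v : wpar (a :: v) = a.2 (+) wpar v.
Proof. exact: big_cons. Qed.

Lemma wsign_cat u v : wsign (u ++ v) = wsign u * wsign v.
Proof. by rewrite /wsign wpar_cat signr_addb. Qed.

Lemma wsign_cons a v : wsign (a :: v) = (-1) ^+ a.2 * wsign v.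
Proof. by rewrite /wsign wpar_cons signr_addb. Qed.

Lemma wsign_sqr u : wsign u * wsign u = 1.
Proof. by rewrite /wsign -signr_addb addbb. Qed.

Definition lact u (m : A) : A := foldr (gmul A) m (map fst u).
Definition ract (m : A) s : A := foldl (gmul A) m (map fst s).
Definition lract u s m := ract (lact u m) s.

Lemma lact_cat u v m : lact (u ++ v) m = lact u (lact v m).
Proof. by rewrite /lact map_cat foldr_cat. Qed.

Lemma lact_gmul u m m' : lact u (gmul A m m') = gmul A (lact u m) m'.
Proof. by elim: u => //= a u; rewrite /lact /= => ->; rewrite gmulA. Qed.

Lemma ract_cat m u v : ract m (u ++ v) = ract (ract m u) v.
Proof. by rewrite /ract map_cat foldl_cat. Qed.

Lemma ract_gmul m m' s : ract (gmul A m m') s = gmul A m (ract m' s).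
Proof. by elim: s m' => //= a s IHs m'; rewrite /ract /= -gmulA; apply: IHs. Qed.

Lemma lact_ract u m s : lact u (ract m s) = lract u s m.
Proof.
elim: s m => [//|a s IHs] m; rewrite /lract /ract /= in IHs *.
by rewrite IHs lact_gmul.
Qed.

Lemma gmul_lact m u m' : gmul A m (lact u m') = gmul A (ract m u) m'.
Proof.
elim: u m => [//|a u IHu] m; rewrite /ract /lact /= in IHu *.
by rewrite gmulA IHu.
Qed.

Lemma lract_cat u u' s s' m : lract (u ++ u') (s' ++ s) m = lract u s (lract u' s' m).
Proof. by rewrite /lract lact_cat ract_cat lact_ract. Qed.

Lemma lract_cat_consl x a u s m :
  lract (x ++ a :: u) s m = lact x (gmul A a.1 (lract u s m)).
Proof.
rewrite {1}/lract lact_cat -/(lract x s _) -lact_ract; congr (lact x _).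
exact: ract_gmul.
Qed.

Lemma lract_cat_consr u s a z m :
  lract u (s ++ a :: z) m = ract (gmul A (lract u s m) a.1) z.
Proof. by rewrite {1}/lract ract_cat. Qed.

Fact lact_is_linear u : linear (lact u).
Proof.
elim: u => [//|a u IHu] k m m'; rewrite /lact /= in IHu *.
by rewrite IHu linearPr.
Qed.
HB.instance Definition _ u := GRing.isLinear.Build F A A *:%R (lact u) (lact_is_linear u).

Fact ract_is_linear s : linear (ract^~ s).
Proof.
elim: s => [//|a s IHs] k m m'; rewrite /ract /= in IHs *.
by rewrite linearPl IHs.
Qed.

Fact lract_is_linear u s : linear (lract u s).
Proof. by move=> k m m'; rewrite /lract linearP ract_is_linear. Qed.
HB.instance Definition _ u s :=
  GRing.isLinear.Build F A A *:%R (lract u s) (lract_is_linear u s).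

(** The action of the symbol [c(L, R)], in left and right multiplications, on a function of
    words. *)
Definition app c (f : seq letter -> A) : seq letter -> A := fun w =>
  cut3 w (fun u v s => c u s *: lract u s (f v)).

Lemma app_delta f : app (delta F) f =1 f.
Proof.
move=> w; rewrite /app /cut3 cut_nill => [|u r _ /negbTE u0]; last first.
  by apply: cut0 => v s _; rewrite /delta u0 scale0r.
rewrite cut_nilr /delta /= ?scale1r // => v s _ /negbTE ->.
by rewrite scale0r.
Qed.

(** Left and right multiplications commute by associativity, so the outer factors of both actions
    merge. Thus word functions form a module over the convolution algebra. *)
Lemma app_app c d f : app c (app d f) =1 app (conv c d) f.
Proof.
move=> w; rewrite {1 2}/app.
transitivity (cut3 w (fun x y z => cut3 y (fun x' y' z' =>
   (c x z * d x' z') *: lract (x ++ x') (z' ++ z) (f y')))).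
  apply: eq_cut3 => u v s _; rewrite (cut3_morph (f := fun m => c u s *: lract u s m)).
    apply: eq_cut3 => x' y' z' _; rewrite linearZ /= scalerA.
    by rewrite lract_cat.
  by move=> m m'; rewrite linearD scalerDr.
rewrite (cut_regroup w (fun x x' y' z' z =>
   (c x z * d x' z') *: lract (x ++ x') (z' ++ z) (f y'))).
apply: eq_cut3 => U v S _; rewrite /conv.
rewrite (cut_morph (f := fun t : F => t *: lract U S (f v))); last first.
  by move=> ? ?; rewrite scalerDl.
apply: eq_cut => x x' xx'.
rewrite (cut_morph (f := fun t : F => t *: lract U S (f v))); last first.
  by move=> ? ?; rewrite scalerDl.
by apply: eq_cut => z' z zz'; rewrite xx' zz'.
Qed.

(** The sign of moving an odd operator past the left word. It respects convolution because [wsign]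
    is multiplicative. *)
Definition twist c : seq letter -> seq letter -> F := fun u s => c u s * wsign u.

Lemma conv_twist c d : conv (twist c) (twist d) =2 twist (conv c d).
Proof.
move=> U S; rewrite /conv /twist cut_mulr; apply: eq_cut => u u' uu'.
rewrite cut_mulr; apply: eq_cut => s' s _.
by rewrite -uu' wsign_cat mulrACA.
Qed.

Lemma twist_delta : twist (delta F) =2 delta F.
Proof.
move=> u s; rewrite /twist /delta; case: u => [|a u] /=; last by rewrite mul0r.
by rewrite /wsign /wpar big_nil mulr1.
Qed.

Lemma app_expdq_beta f : app (twist (@expdq _ F)) (app (twist (@beta _ F)) f) =1 f.
Proof.
move=> w; rewrite app_app -[RHS](app_delta f).
apply: eq_cut3 => u v s _; congr (_ *: _).
rewrite conv_twist -(twist_delta u s) /twist; congr (_ * _).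
exact: conv_expdq_beta.
Qed.

Variable e : A.

(** The component of [T(exp(a) e)] on the word [v]. *)
Definition core (T : A -> A) : seq letter -> A := fun v =>
  (size v)`!%:R^-1 *: T (lact v e).

(* The Koszul bracket of [T] before symmetrization. *)
Definition psi (T : A -> A) (epsT : bool) : seq letter -> A :=
  app (if epsT then twist (@beta _ F) else @beta _ F) (core T).

(** The inner operation is odd in suspended parity: hence the sign [wsign x] for passing [x] and the
    parity [~~ wpar y] declared for the new letter. *)
Definition comp_psi (T T' : A -> A) : seq letter -> A := fun w =>
  cut3 w (fun x y z =>
    wsign x *: psi T true (x ++ (psi T' true y, ~~ wpar y) :: z)).

Variable T : {linear A -> A}.
Local Notation b := (psi T true).
Local Notation t := (core T).
Local Notation bl y := (b y, ~~ wpar y).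

(** Normal form of a term with two factors [b]: the product of [x], [b y], [u], [b v], [s] in this
    order. *)
Definition pairact x y u v s : A := lact x (gmul A (b y) (lract u s (b v))).

Lemma pairactE x y u v s : pairact x y u v s = ract (gmul A (lract x u (b y)) (b v)) s.
Proof.
rewrite /pairact {1}/lract -ract_gmul lact_ract /lract gmul_lact lact_gmul.
by rewrite lact_ract.
Qed.

(** Inverting the symbol in [psi] expresses [T(exp(a) e)] through the vector field itself. *)
Lemma core_psi : t =1 app (twist (@expdq _ F)) b.
Proof. by move=> v; rewrite app_expdq_beta. Qed.

(** The new letter falls inside the argument of the outer [T]. The inverse factorial in [core] is
    then [expdq v v'], so summing over [v], [y], [v'] turns [psi] back into [core] by [core_psi],
    which leaves [T R_e T]. *)
Lemma comp_psi_mid w :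
  cut3 w (fun x y z => wsign x *: cut x (fun u v => cut z (fun v' s =>
    twist (@beta _ F) u s *: lract u s (t (v ++ bl y :: v'))))) =
  psi (T \o rmul e \o T) false w.
Proof.
transitivity (cut3 w (fun u Y s => cut3 Y (fun v y v' =>
  (beta F u s * twist (@expdq _ F) v v') *: lract u s (T (rmul e (lract v v' (b y))))))).
  rewrite (cut_regroup w (fun u v y v' s =>
  (beta F u s * twist (@expdq _ F) v v') *: lract u s (T (rmul e (lract v v' (b y)))))).
  apply: eq_cut3 => x y z _.
  rewrite (cut_morph (f := *:%R (wsign x))); last exact: scalerDr.
  apply: eq_cut => u v uv.
  rewrite (cut_morph (f := *:%R (wsign x))); last exact: scalerDr.
  apply: eq_cut => v' s vs.
  rewrite scalerA /core !linearZ /= scalerA; congr (_ *: _).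
    rewrite /twist -uv wsign_cat /expdq size_cat /= addnS.
    (* The inner operation passes [u ++ v] and the outer one passes [u]; what remains is [wsign v],
       the twist of [expdq]. *)
    rewrite [LHS](_ : _ = wsign u * wsign u *
        (beta F u s * (((size v + size v').+1)`!%:R^-1 * wsign v))).
      by rewrite wsign_sqr mul1r mulrA.
    by ring.
  suff -> : lact (v ++ bl y :: v') e = rmul e (lract v v' (b y)) by [].
  rewrite lact_cat; have -> : lact (bl y :: v') e = gmul A (b y) (lact v' e) by [].
  by rewrite gmul_lact lact_gmul lact_ract.
apply: eq_cut3 => u Y s _.
have -> : core (T \o rmul e \o T) Y = T (rmul e (t Y)).
  by rewrite /core /rmul linearZl_LR linearZ.
rewrite core_psi (cut3_morph (f := fun m => beta F u s *: lract u s (T (rmul e m)))).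
  apply: eq_cut3 => v y v' _.
  by rewrite /rmul linearZl_LR 2!linearZ /= scalerA.
by move=> m m'; rewrite /rmul linearDl 2!linearD /= scalerDr.
Qed.

(** The new letter falls outside the argument of the outer [T], to its left in the first sum and to
    its right in the second. Expanding [t] by [core_psi] gives terms [pairact] in both; only in the
    first does the outer operator pass the new letter, whose extra oddness gives a minus sign. The
    coefficients agree by [hesslE]. *)
Lemma comp_psi_leftright w :
  cut3 w (fun x y z => wsign x *: cut3 z (fun u v s =>
    twist (@beta _ F) (x ++ bl y :: u) s *: lract (x ++ bl y :: u) s (t v)))
  + cut3 w (fun x y z => wsign x *: cut3 x (fun u v s =>
    twist (@beta _ F) u (s ++ bl y :: z) *: lract u (s ++ bl y :: z) (t v))) = 0.
Proof.
(* Any letter will do, since [beta] sees only lengths. *)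
pose o : letter := (0, false).
set U := (X in X + _); set S := (X in _ + X).
have UE : U = cut3 w (fun x y r => cut3 r (fun u v s =>
    - ((hessl F o x u s * (wsign y * wsign u)) *: pairact x y u v s))).
  apply: eq_cut3 => x y z _.
  transitivity (cut3 z (fun z1 v s => cut3 v (fun p v' q =>
     - (((beta F (x ++ o :: z1) s * expdq F p q) * (wsign y * wsign (z1 ++ p)))
       *: pairact x y (z1 ++ p) v' (q ++ s))))).
    rewrite (cut3_morph (f := *:%R (wsign x))); last exact: scalerDr.
    apply: eq_cut3 => z1 v s _; rewrite core_psi /app scalerA.
    rewrite (cut3_morph (f := fun m => _ *: lract _ _ m)); last first.
      by move=> m m'; rewrite linearD scalerDr.
    apply: eq_cut3 => p v' q _; rewrite linearZ /= scalerA -scaleNr.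
    rewrite lract_cat_consl -lract_cat; congr (_ *: _).
    have -> : twist (@beta _ F) (x ++ bl y :: z1) s =
        - (beta F (x ++ o :: z1) s * (wsign x * wsign y * wsign z1)).
      by rewrite /twist wsign_cat wsign_cons /= signrN /beta !size_cat /wsign /=; ring.
    rewrite [LHS](_ : _ = wsign x * wsign x * - (beta F (x ++ o :: z1) s * expdq F p q
       * (wsign y * (wsign z1 * wsign p)))); last by rewrite /twist; ring.
    by rewrite wsign_sqr mul1r wsign_cat.
  rewrite (cut_regroup z (fun z1 p v' q s =>
     - (((beta F (x ++ o :: z1) s * expdq F p q) * (wsign y * wsign (z1 ++ p)))
       *: pairact x y (z1 ++ p) v' (q ++ s)))).
  apply: eq_cut3 => u v s _; rewrite /hessl.
  pose f (k : F) := - (k * (wsign y * wsign u) *: pairact x y u v s).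
  have fD : {morph f : k k' / k + k'} by move=> k k'; rewrite /f mulrDl scalerDl opprD.
  rewrite -[RHS]/(f _) (cut_morph _ _ fD); apply: eq_cut => z1 p zp.
  rewrite (cut_morph _ _ fD); apply: eq_cut => q s' qs.
  by rewrite /f zp qs.
(* The roles are exchanged here: the outer [T] supplies the left factor [b y], and the new letter is
   the right factor [b v]. *)
have SE : S = cut3 w (fun x y r => cut3 r (fun u v s =>
    (hessr F o x u s * (wsign y * wsign u)) *: pairact x y u v s)).
  rewrite -(cut5A w (fun x y u v s =>
    (hessr F o x u s * (wsign y * wsign u)) *: pairact x y u v s)).
  apply: eq_cut3 => X v z _.
  transitivity (cut3 X (fun x1 y' s => cut3 y' (fun p y q =>
     (((beta F x1 (s ++ o :: z) * expdq F p q) * (wsign y * wsign (q ++ s)))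
       *: pairact (x1 ++ p) y (q ++ s) v z)))).
    rewrite (cut3_morph (f := *:%R (wsign X))); last exact: scalerDr.
    apply: eq_cut3 => x1 y' s XE; rewrite core_psi /app scalerA.
    rewrite (cut3_morph (f := fun m => _ *: lract _ _ m)); last first.
      by move=> m m'; rewrite linearD scalerDr.
    apply: eq_cut3 => p y q y'E; rewrite linearZ /= scalerA.
    rewrite lract_cat_consr -lract_cat -pairactE; congr (_ *: _).
    have -> : twist (@beta _ F) x1 (s ++ bl v :: z) = beta F x1 (s ++ o :: z) * wsign x1.
      by rewrite /twist /beta !size_cat.
    rewrite [LHS](_ : _ = wsign x1 * wsign x1 * (wsign p * wsign p) *
       (beta F x1 (s ++ o :: z) * expdq F p q * (wsign y * (wsign q * wsign s)))).
      by rewrite !wsign_sqr !mul1r wsign_cat.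
    by rewrite -XE -y'E !wsign_cat /twist; ring.
  rewrite (cut_regroup X (fun x1 p y q s =>
     (((beta F x1 (s ++ o :: z) * expdq F p q) * (wsign y * wsign (q ++ s)))
       *: pairact (x1 ++ p) y (q ++ s) v z))).
  apply: eq_cut3 => x y u _; rewrite /hessr.
  pose f (k : F) := (k * (wsign y * wsign u) *: pairact x y u v z).
  have fD : {morph f : k k' / k + k'} by move=> k k'; rewrite /f mulrDl scalerDl.
  rewrite -[RHS]/(f _) (cut_morph _ _ fD); apply: eq_cut => x1 p xp.
  rewrite (cut_morph _ _ fD); apply: eq_cut => q s qs.
  by rewrite /f xp qs.
rewrite UE SE -cut3D; apply: cut3_0 => x y r.
rewrite -cut3D; apply: cut3_0 => u v s.
by rewrite hesslE addNr.
Qed.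

(** The terms are sorted by the position of the new letter relative to the argument of the outer
    [T]. *)
Theorem comp_psiE w : comp_psi T T w = psi (T \o rmul e \o T) false w.
Proof.
rewrite -comp_psi_mid -[RHS]add0r -(comp_psi_leftright w) -!cut3D /comp_psi.
apply: eq_cut3 => x y z _.
rewrite {1}/psi {1}/app cut3_cat_cons.
by rewrite !scalerDr [LHS]addrC [LHS]addrA.
Qed.

End WordIdentity.

(** * Signed sums over permutations *)

Section CutOrd.
Variables (L : Type) (V : nmodType).

Lemma cut_map (L' : Type) (f : L -> L') w (G : seq L' -> seq L' -> V) :
  cut (map f w) G = cut w (fun u v => G (map f u) (map f v)).
Proof. by elim: w G => [|a w IHw] G //=; rewrite IHw. Qed.

Lemma cut3_map (L' : Type) (f : L -> L') w (G : seq L' -> seq L' -> seq L' -> V) :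
  cut3 (map f w) G = cut3 w (fun u v s => G (map f u) (map f v) (map f s)).
Proof. by rewrite /cut3 cut_map; apply: eq_cut => u r _; rewrite cut_map. Qed.

Lemma cut3_ord (w : seq L) n (G : seq L -> seq L -> seq L -> V) : size w = n ->
  cut3 w G = \sum_(i < n.+1) \sum_(j < n.+1 | (i + j <= n)%N)
    G (take i w) (take j (drop i w)) (drop (i + j) w).
Proof.
move=> <-; rewrite /cut3 cut_ord; apply: eq_bigr => i _.
rewrite cut_ord size_drop (big_ord_widen_cond (size w).+1 xpredT
  (fun j => G (take i w) (take j (drop i w)) (drop j (drop i w)))); last first.
  by rewrite ltnS leq_subr.
have := ltn_ord i; rewrite ltnS => iw.
apply: eq_big => [j | j _]; last by rewrite drop_drop addnC.
by rewrite ltnS leq_subRL.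
Qed.

End CutOrd.

(** * Sums over the orderings of a duplicate-free list *)

Section PermutationSums.
Variables (L : eqType) (V : nmodType).
Implicit Types (l u v w x y z : seq L).

(** Serves to prove bijectivity by counting: one inclusion and a comparison of sizes suffice. *)
Lemma perm_sub_size (T : eqType) (s1 s2 : seq T) :
  uniq s1 -> {subset s1 <= s2} -> (size s2 <= size s1)%N -> perm_eq s1 s2.
Proof.
move=> u1 s12 le21; have [_ eq12] := uniq_min_size u1 s12 le21.
by apply: uniq_perm => //; apply: leq_size_uniq le21.
Qed.

(** Arguments of a bracket may coincide, so orderings are taken of a list of distinct labels, mapped
    to the arguments only afterwards. *)
Definition permword l n (pi : 'S_n) (x0 : L) : seq L :=
  [seq nth x0 l (pi i) | i <- enum 'I_n].

Lemma size_permword l n (pi : 'S_n) (x0 : L) : size (permword l pi x0) = n.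
Proof. by rewrite size_map size_enum_ord. Qed.

Lemma nth_permword l n (pi : 'S_n) (x0 : L) (i : 'I_n) :
  nth x0 (permword l pi x0) i = nth x0 l (pi i).
Proof.
by rewrite (nth_map i) ?size_enum_ord // nth_ord_enum.
Qed.

Lemma perm_permword l n (pi : 'S_n) (x0 : L) : uniq l -> size l = n ->
  perm_eq (permword l pi x0) l.
Proof.
move=> ul sl; rewrite perm_sym; apply: perm_sub_size => //.
  move=> y yl; apply/mapP; have lt : (index y l < n)%N by rewrite -sl index_mem.
  exists ((pi^-1)%g (Ordinal lt)); first by rewrite mem_enum.
  by rewrite permKV /= nth_index.
by rewrite size_permword sl.
Qed.

Lemma sum_permword l n (x0 : L) (G : seq L -> V) : uniq l -> size l = n ->
  \sum_(pi : 'S_n) G (permword l pi x0) = \sum_(v <- permutations l) G v.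
Proof.
move=> ul sl; rewrite -(big_map (fun pi => permword l pi x0) predT G).
apply: perm_big; apply: perm_sub_size.
- rewrite map_inj_uniq ?index_enum_uniq // => pi pi' eqw.
  apply/permP => i; have := congr1 (fun w => nth x0 w i) eqw.
  by move/eqP; rewrite !nth_permword nth_uniq ?sl // => /eqP/val_inj.
- by move=> w /mapP[pi _ ->]; rewrite mem_permutations perm_permword.
- rewrite size_permutations // size_map sl -card_Sn -sum1_card -sum1_size.
  by rewrite leq_eqVlt; apply/orP; left; apply/eqP; apply: eq_bigl.
Qed.

(** Inserting [a] at every position of every ordering of [l] reaches each ordering of [a :: l]
    exactly once. *)
Lemma sum_permutations_cons a l (G : seq L -> V) : uniq (a :: l) ->
  \sum_(v <- permutations (a :: l)) G v =
  \sum_(z <- permutations l) cut z (fun x z' => G (x ++ a :: z')).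
Proof.
move=> ual; have /andP[al ul] := ual.
transitivity (\sum_(z <- permutations l) \sum_(i <- iota 0 (size l).+1)
   G (take i z ++ a :: drop i z)).
  rewrite -(big_allpairs_dep (h := fun z i => take i z ++ a :: drop i z)
    (r2 := fun _ => iota 0 (size l).+1) (F := G)).
  apply: perm_big; apply: perm_sub_size; first exact: permutations_uniq.
    move=> v; rewrite mem_permutations => vP.
    have av : a \in v by rewrite (perm_mem vP) mem_head.
    case/splitPr: av vP => x z' vP; apply/allpairsPdep; exists (x ++ z'), (size x).
    rewrite mem_permutations mem_iota take_size_cat // drop_size_cat //; split=> //.
      by have := vP; rewrite -cat1s perm_catCA perm_cons.
    have := perm_size vP; rewrite size_cat /= addnS add0n ltnS => -[<-].
    exact: leq_addr.
  rewrite size_allpairs_dep sumnE big_map big_const_seq count_predT.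
  by rewrite size_permutations // size_permutations //= size_iota iter_addn_0 factS.
apply: eq_big_seq => z; rewrite mem_permutations => /perm_size <-.
rewrite cut_ord -(big_mkord xpredT (fun i => G (take i z ++ a :: drop i z))).
by rewrite /index_iota subn0.
Qed.

(** For fixed block lengths, exchanging the first two blocks is a bijection between orderings of
    [l]. *)
Lemma sum_cut3_swap l (G : seq L -> seq L -> seq L -> V) : uniq l ->
  \sum_(w <- permutations l) cut3 w G =
  \sum_(w <- permutations l) cut3 w (fun x y z => G y x z).
Proof.
move=> ul; pose n := size l.
have sz w : w \in permutations l -> size w = n.
  by rewrite mem_permutations => /perm_size.
transitivity (\sum_(i < n.+1) \sum_(j < n.+1 | (i + j <= n)%N)
   \sum_(w <- permutations l) G (take i w) (take j (drop i w)) (drop (i + j) w)).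
  transitivity (\sum_(w <- permutations l) \sum_(i < n.+1) \sum_(j < n.+1 | (i + j <= n)%N)
     G (take i w) (take j (drop i w)) (drop (i + j) w)).
    by apply: eq_big_seq => w /sz szw; rewrite (cut3_ord _ szw).
  by rewrite exchange_big; apply: eq_bigr => i _; rewrite exchange_big.
transitivity (\sum_(i < n.+1) \sum_(j < n.+1 | (i + j <= n)%N)
   \sum_(w <- permutations l) G (take j (drop i w)) (take i w) (drop (i + j) w)); last first.
  transitivity (\sum_(w <- permutations l) \sum_(i < n.+1) \sum_(j < n.+1 | (i + j <= n)%N)
     G (take j (drop i w)) (take i w) (drop (i + j) w)).
    by rewrite exchange_big; apply: eq_bigr => i _; rewrite [RHS]exchange_big.
  by apply: eq_big_seq => w /sz szw; rewrite (cut3_ord _ szw).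
rewrite (exchange_big_dep predT) //=; apply: eq_bigr => i _.
under [RHS]eq_bigl => j do rewrite addnC.
apply: eq_bigr => j le_n.
pose f w := take j (drop i w) ++ take i w ++ drop (i + j) w.
have fE w : w \in permutations l -> [/\ take j (f w) = take j (drop i w),
    take i (drop j (f w)) = take i w & drop (j + i) (f w) = drop (i + j) w].
  move=> /sz szw; have s1 : size (take j (drop i w)) = j.
    by rewrite size_takel // size_drop szw; lia.
  have s2 : size (take i w) = i by rewrite size_takel // szw; lia.
  rewrite /f take_size_cat // drop_size_cat // take_size_cat //; split=> //.
  by rewrite addnC -drop_drop drop_size_cat // drop_size_cat.
transitivity (\sum_(w <- map f (permutations l))
    G (take j w) (take i (drop j w)) (drop (j + i) w)).
  apply: perm_big; rewrite perm_sym; apply: perm_sub_size; last by rewrite size_map.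
    rewrite map_inj_in_uniq ?permutations_uniq // => w w' wl wl' eqf.
    have [e1 e2 e3] := fE w wl; have [e1' e2' e3'] := fE w' wl'.
    rewrite -[w](cat_take_drop i) -[w'](cat_take_drop i).
    rewrite -[drop i w](cat_take_drop j) -[drop i w'](cat_take_drop j).
    by rewrite !drop_drop ![(j + i)%N]addnC -e1 -e1' -e2 -e2' -e3 -e3' eqf.
  move=> _ /mapP[w wl ->]; move: wl; rewrite !mem_permutations => /permPr <-.
  rewrite /f catA perm_sym -{1}[w](cat_take_drop i) -{1}[drop i w](cat_take_drop j).
  rewrite catA drop_drop [(j + i)%N]addnC perm_cat2r.
  by rewrite perm_catC.
rewrite big_map; apply: eq_big_seq => w wl.
by have [-> -> ->] := fE w wl; rewrite addnC.
Qed.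

(** Each ordering is reached from $k!(n-k)!$ orderings by rearranging inside the two blocks, where
    $n$ is the size of [l]. This multiplicity cancels the denominators of [bracket_comp]. *)
Lemma sum_permutations_take_drop l k (G : seq L -> seq L -> V) :
  uniq l -> (k <= size l)%N ->
  \sum_(w <- permutations l) \sum_(y <- permutations (take k w))
    \sum_(z <- permutations (drop k w)) G y z =
  (\sum_(w <- permutations l) G (take k w) (drop k w)) *+ (k`! * (size l - k)`!).
Proof.
(* [C w v] says that [v] is [w] rearranged inside the two blocks. It is symmetric, so its pairs can
   be counted from either side. *)
move=> ul kl; pose C w v := perm_eq (take k v) (take k w) && perm_eq (drop k v) (drop k w).
have CP w : w \in permutations l -> perm_eq
    [seq y ++ z | y <- permutations (take k w), z <- permutations (drop k w)]
    [seq v <- permutations l | C w v].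
  rewrite mem_permutations => wl; have uw : uniq w by rewrite (perm_uniq wl).
  have szw := perm_size wl.
  have szt : size (take k w) = k by rewrite size_takel // szw.
  apply: uniq_perm.
  - apply: allpairs_uniq; rewrite ?permutations_uniq //.
    move=> [y z] [y' z'] /allpairsP[[y1 z1] /= [h1 _ [-> _]]].
    move=> /allpairsP[[y2 z2] /= [h2 _ [-> _]]] /eqP.
    rewrite !mem_permutations in h1 h2.
    rewrite eqseq_cat; last by rewrite (perm_size h1) (perm_size h2).
    by case/andP=> /eqP -> /eqP ->.
  - by rewrite filter_uniq // permutations_uniq.
  move=> v; rewrite mem_filter mem_permutations; apply/allpairsP/andP => /=.
    move=> [[y z] /= []]; rewrite !mem_permutations => h1 h2 ->.
    have szy : size y = k by rewrite (perm_size h1).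
    rewrite /C take_size_cat // drop_size_cat // h1 h2; split=> //.
    rewrite -(permPr wl) -[w](cat_take_drop k).
    by rewrite -[X in perm_eq X](cat_take_drop k) take_size_cat // drop_size_cat // perm_cat.
  move=> [/andP[h1 h2] vl]; exists (take k v, drop k v) => /=.
  by rewrite !mem_permutations h1 h2 cat_take_drop.
have sizeP w : w \in permutations l -> count (C w) (permutations l) = (k`! * (size l - k)`!)%N.
  move=> wl; rewrite -size_filter -(perm_size (CP w wl)) size_allpairs.
  move: wl; rewrite mem_permutations => wl; have uw : uniq w by rewrite (perm_uniq wl).
  have szw := perm_size wl.
  rewrite !size_permutations ?take_uniq ?drop_uniq // size_drop szw.
  by rewrite size_takel // szw.
transitivity (\sum_(w <- permutations l) \sum_(v <- permutations l | C w v)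
   G (take k v) (drop k v)).
  apply: eq_big_seq => w wl; rewrite -[RHS]big_filter -(perm_big _ (CP w wl)) big_allpairs_dep.
  apply: eq_big_seq => y; rewrite mem_permutations => yP; apply: eq_bigr => z _.
  have szy : size y = k.
    rewrite (perm_size yP) size_takel //.
    by move: wl; rewrite mem_permutations => /perm_size ->.
  by rewrite take_size_cat // drop_size_cat.
rewrite (exchange_big_dep predT) //= -sumrMnl; apply: eq_big_seq => v vl.
rewrite big_const_seq iter_addr_0 -(sizeP v vl); congr (_ *+ _).
by apply: eq_count => w; rewrite /C [RHS]andbC perm_sym andbC; congr (_ && _); rewrite perm_sym.
Qed.

End PermutationSums.

(** * Koszul signs as inversions of odd labels *)

Section InversionSign.
Variable p : nat -> bool.
Implicit Types (u v w x y z : seq nat).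

(** The inversions of odd labels between the two words when [u] is placed before [v]. *)
Definition cross u v : bool :=
  \big[addb/false]_(a <- u) \big[addb/false]_(b <- v | (b < a)%N) (p a && p b).

(* Parity of the number of inversions between odd letters of [w]. *)
Fixpoint oddinv w : bool := if w is a :: w' then cross [:: a] w' (+) oddinv w' else false.

Definition odd_par w : bool := \big[addb/false]_(a <- w) p a.

Lemma perm_cross u u' v v' : perm_eq u u' -> perm_eq v v' -> cross u v = cross u' v'.
Proof.
move=> uu' vv'; rewrite /cross (perm_big _ uu'); apply: eq_bigr => a _.
exact: perm_big.
Qed.

Lemma cross_catl u u' v : cross (u ++ u') v = cross u v (+) cross u' v.
Proof. exact: big_cat. Qed.

Lemma cross_catr u v v' : cross u (v ++ v') = cross u v (+) cross u v'.
Proof. by rewrite /cross -big_split; apply: eq_bigr => a _; rewrite big_cat. Qed.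

Lemma oddinv_cat u v : oddinv (u ++ v) = oddinv u (+) oddinv v (+) cross u v.
Proof.
elim: u => [|a u IHu] /=; first by rewrite /cross big_nil addbF.
rewrite IHu cross_catr -(cat1s a u) cross_catl.
by move: (oddinv u) (oddinv v) (cross u v) (cross _ u) (cross _ v) => [] [] [] [] [].
Qed.

(** Two distinct labels are inverted in exactly one of the two orders, so every odd pair is counted
    once. *)
Lemma cross_swap u v : (forall a b, a \in u -> b \in v -> a != b) ->
  cross u v (+) cross v u = odd_par u && odd_par v.
Proof.
have cross1 a v' : a \notin v' -> cross [:: a] v' (+) cross v' [:: a] = p a && odd_par v'.
  elim: v' => [|b v' IHv]; first by rewrite /cross /odd_par !big_nil big_seq1 big_nil andbF.
  rewrite inE negb_or => /andP[ab /IHv {}IHv].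
  rewrite -(cat1s b v') cross_catl cross_catr addbACA IHv /odd_par big_cat /= andb_addr.
  congr (_ (+) _); rewrite /cross !big_seq1 ![in LHS]big_mkcond !big_seq1 big_mkcond big_seq1.
  by case: ltngtP ab => //= _ _; rewrite ?addbF // andbC.
elim: u => [|a u IHu] uv.
  by rewrite /odd_par big_nil /cross big_nil big1 // => b _; rewrite big_nil.
rewrite -(cat1s a u) cross_catl cross_catr addbACA IHu; last first.
  by move=> b c bu; apply: uv; rewrite inE bu orbT.
rewrite cross1 ?/odd_par ?big_cat ?big_seq1 ?andb_addl //.
by apply/negP => av; have := uv a a (mem_head _ _) av; rewrite eqxx.
Qed.

(** Exchanging neighbours affects only the inversion between them; this is the defining rule of the
    Koszul sign. *)
Lemma oddinv_adjacent u a b v : a != b ->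
  oddinv (u ++ a :: b :: v) = (p a && p b) (+) oddinv (u ++ b :: a :: v).
Proof.
move=> ab; rewrite !oddinv_cat.
have -> : cross u (a :: b :: v) = cross u (b :: a :: v).
  by apply: perm_cross => //; rewrite -(cat1s a) -(cat1s b) perm_catCA.
have -> : oddinv (a :: b :: v) = (p a && p b) (+) oddinv (b :: a :: v).
  have := @cross_swap [:: a] [:: b]; rewrite /odd_par !big_seq1 => <-; last first.
    by move=> c d; rewrite !inE => /eqP -> /eqP ->.
  rewrite /= -(cat1s b v) -(cat1s a v) !cross_catr.
  by move: (cross _ _) (cross _ _) (cross _ v) (cross _ v) (oddinv v) => [] [] [] [] [].
by move: (oddinv u) (cross u _) (oddinv (b :: _)) (p a && p b) => [] [] [] [].
Qed.

Lemma adjacent_wordE (w w' : seq nat) n (r r' : 'I_n) : r' = r.+1 :> nat ->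
  size w = n -> size w' = n ->
  (forall i : 'I_n, nth 0%N w' i = nth 0%N w (tperm r r' i)) ->
  let u := take r w in let v := drop r.+2 w in
  w = u ++ nth 0%N w r :: nth 0%N w r' :: v /\
  w' = u ++ nth 0%N w r' :: nth 0%N w r :: v.
Proof.
move=> rr' sw sw' ww' u v.
have r'n : (r.+1 < n)%N by rewrite -rr'.
have wE : w = u ++ nth 0%N w r :: nth 0%N w r' :: v.
  rewrite -{1}[w](cat_take_drop r); congr (_ ++ _).
  by rewrite (drop_nth 0%N) ?sw // (drop_nth 0%N) ?sw // rr'.
have neq : r != r' by rewrite -val_eqE /= rr' neq_ltn ltnSn.
have other (i : 'I_n) : i != r :> nat -> i != r' :> nat -> nth 0%N w' i = nth 0%N w i.
  by rewrite !val_eqE => i1 i2; rewrite ww' tpermD // eq_sym.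
split=> //; rewrite -[w'](cat_take_drop r) (drop_nth 0%N) ?sw' // (drop_nth 0%N) ?sw' //.
rewrite -rr' ww' tpermL ww' tpermR; congr (_ ++ _ :: _ :: _); apply: (@eq_from_nth _ 0%N).
- by rewrite !size_take sw sw'.
- move=> i; rewrite size_takel ?sw' ?(ltnW (ltn_ord r)) // => ir.
  rewrite !nth_take //; apply: (other (Ordinal (ltn_trans ir (ltn_ord r)))) => /=.
    by rewrite neq_ltn ir.
  by rewrite rr' neq_ltn ltnS ltnW.
- by rewrite /v !size_drop sw sw' rr'.
move=> i; rewrite size_drop sw' => ir; rewrite /v !nth_drop rr'.
have lt : (r.+2 + i < n)%N by lia.
by apply: (other (Ordinal lt)) => /=; lia.
Qed.

End InversionSign.

(** * Symmetrization *)

Lemma eq_oddinv (p p' : nat -> bool) (w : seq nat) :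
  (forall a, a \in w -> p a = p' a) -> oddinv p w = oddinv p' w.
Proof.
elim: w => [//|a w IHw] pp' /=.
rewrite IHw => [|b bw]; last by apply: pp'; rewrite inE bw orbT.
congr (_ (+) _); rewrite /cross !big_seq1 big_seq_cond [RHS]big_seq_cond.
apply: eq_bigr => b /andP[bw _].
by rewrite !pp' ?mem_head // inE bw orbT.
Qed.

Lemma eq_odd_par (p p' : nat -> bool) (w : seq nat) :
  (forall a, a \in w -> p a = p' a) -> odd_par p w = odd_par p' w.
Proof. by move=> pp'; apply: eq_big_seq. Qed.

(** The largest label is inverted with exactly the labels behind it, so moving it behind [x] removes
    its inversions with [x] and no others. *)
Lemma oddinv_insert_max (p : nat -> bool) N x z : {in x ++ z, forall b, (b < N)%N} ->
  oddinv p (x ++ N :: z) (+) oddinv p (N :: x ++ z) = p N && odd_par p x.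
Proof.
move=> ltN; rewrite -cat1s -(cat1s N (x ++ z)) !oddinv_cat !cross_catr.
have := @cross_swap p [:: N] x; rewrite {1}/odd_par big_seq1 => <-; last first.
  by move=> a b; rewrite inE => /eqP -> bx; rewrite neq_ltn ltN ?orbT // mem_cat bx.
move: (oddinv p x) (oddinv p z) (oddinv p [:: N]) (cross p x z) (cross p [:: N] z).
by move: (cross p x [:: N]) (cross p [:: N] x) => [] [] [] [] [] [] [].
Qed.

Lemma linear_sum_scale (F : nzRingType) (V W : lmodType F) (I : Type) (g : V -> W)
    (s : seq I) (k : I -> F) (c : I -> V) : linear g ->
  g (\sum_(y <- s) k y *: c y) = \sum_(y <- s) k y *: g (c y).
Proof.
move=> gP; elim: s => [|y s IHs]; last by rewrite !big_cons gP IHs.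
(* Linearity gives [g 0 = - g 0 + g 0], which is [0]. *)
by rewrite !big_nil -{1}[0]addr0 -{1}[0](scaler0 _ (-1)) gP scaleN1r addNr.
Qed.

Section Symmetrization.
Variables (F : numFieldType) (eps : bool) (A : gradedAlgebra F eps) (e : A).
Local Notation letter := (A * bool)%type.
Implicit Types (u v w s : seq letter) (T : A -> A).

Lemma gmul0x (m : A) : gmul A 0 m = 0.
Proof. by rewrite linear0l. Qed.

Lemma gmulx0 (m : A) : gmul A m 0 = 0.
Proof. by rewrite linear0r. Qed.

Lemma lact_zero u m : 0 \in map fst u -> lact u m = 0.
Proof.
elim: u => [//|a u IHu]; rewrite inE => /orP[/eqP a0|/IHu u0].
  by rewrite /lact /= -a0 gmul0x.
by rewrite -[lact _ _]/(gmul A a.1 (lact u m)) u0 gmulx0.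
Qed.

Lemma ract0 s : ract (0 : A) s = 0.
Proof. by elim: s => [//|a s IHs]; rewrite /ract /= gmul0x; apply: IHs. Qed.

Lemma ract_zero s m : 0 \in map fst s -> ract m s = 0.
Proof.
elim: s m => [//|a s IHs] m; rewrite inE => /orP[/eqP a0|/IHs s0]; last exact: s0.
by rewrite /ract /= -a0 gmulx0; apply: ract0.
Qed.

Definition term T w (i j : nat) : A :=
  lract (take i w) (drop (i + j) w) (T (lact (take j (drop i w)) e)).

(** Disposes of words containing [0], for which computed and declared parity may differ. *)
Lemma term_zero T w i j : T 0 = 0 -> 0 \in map fst w -> term T w i j = 0.
Proof.
move=> T0 w0; rewrite /term /lract.
have : 0 \in map fst (take i w ++ take j (drop i w) ++ drop (i + j) w).
  by rewrite addnC -drop_drop !cat_take_drop.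
rewrite !map_cat !mem_cat => /or3P[u0|v0|s0]; last exact: ract_zero.
  by rewrite lact_zero // ract0.
by rewrite (lact_zero _ v0) T0 -[lact _ 0]/(lract _ [::] 0) linear0 ract0.
Qed.

Lemma psi_ord T epsT w n : size w = n -> psi e T epsT w =
  \sum_(i < n.+1) \sum_(j < n.+1) \sum_(k < n.+1 | (i + j + k)%N == n)
    (koszul_number F i k / (i`! * j`! * k`!)%:R) *:
      ((-1) ^+ (epsT && wpar (take i w)) *: term T w i j).
Proof.
move=> sw; rewrite /psi /app (cut3_ord _ sw); apply: eq_bigr => i _.
rewrite big_mkcond; apply: eq_bigr => j _; case: ifP => [le_n|/negbT gt_n]; last first.
  by rewrite big_pred0 // => k; apply/negbTE; lia.
have lt : (n - (i + j) < n.+1)%N by lia.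
rewrite (big_pred1 (Ordinal lt)) => [|k]; last first.
  by apply/eqP/eqP => [kE|-> /=]; [apply: val_inj => /=; lia | lia].
rewrite /core linearZ /= -/(term T w i j) !scalerA; congr (_ *: _).
have si : size (take i w) = i by rewrite size_takel // sw; lia.
have sj : size (take j (drop i w)) = j by rewrite size_takel // size_drop sw; lia.
have sk : size (drop (i + j) w) = (n - (i + j))%N by rewrite size_drop sw.
rewrite sj /twist /beta /egf2 /wsign.
have -> (b : bool) (f g : seq letter -> seq letter -> F) u v :
  (if b then f else g) u v = if b then f u v else g u v by case: b.
rewrite si sk.
have neq0 := fact_neq0 F.
by case: (epsT) => /=; rewrite ?expr0 ?mulr1 !natrM; field; rewrite !neq0.
Qed.

Definition homletter (a : letter) := a.1 \in gpart A (a.2 (+) eps).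

Lemma homletter_parity a : homletter a -> a.1 != 0 -> parity a.1 (+) eps = a.2.
Proof.
case: a => m q; rewrite /homletter /parity /= => hm /eqP m0.
suff -> : (m \in gpart A true) = q (+) eps by rewrite -addbA addbb addbF.
case: (q (+) eps) hm => [-> //|mf].
by apply/negbTE/negP => mt; apply: m0; apply: (gpart_direct mf mt).
Qed.

Lemma odd_sum_parity w : {in w, forall a, parity a.1 (+) eps = a.2} ->
  odd (\sum_(m <- map fst w) parity m + size w * eps)%N = wpar w.
Proof.
elim: w => [|a w IHw] hw; first by rewrite big_nil /wpar big_nil.
rewrite big_cons wpar_cons -IHw => [|b bw]; last by apply: hw; rewrite inE bw orbT.
rewrite -hw ?mem_head //= mulSn !oddD !oddb.
by move: (odd _) (odd _) (parity _) => [] [] []; case: eps.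
Qed.

(** The right-hand side obeys the rule for neighbours, and that rule determines the sign. The
    summand [oddinv p l] normalizes it at the identity, as [l] need not be increasing. *)
Lemma koszul_sign_inv n (a : n.-tuple A) (p : nat -> bool) l (pi : 'S_n) :
  uniq l -> size l = n ->
  (forall r : 'I_n, parity (tnth a r) (+) eps = p (nth 0%N l r)) ->
  koszul_sign a pi = oddinv p (permword l pi 0%N) (+) oddinv p l.
Proof.
move=> ul sl ap.
apply: (koszul_sign_uniq (koszul_signP a)
  (sg' := fun pi => oddinv p (permword l pi 0%N) (+) oddinv p l)).
split=> [|{}pi r r' rr'].
  suff -> : permword l (1%g : 'S_n) 0%N = l by rewrite addbb.
  apply: (@eq_from_nth _ 0%N); rewrite size_permword // => i lt.
  by rewrite (nth_permword _ _ _ (Ordinal lt)) perm1.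
have ww' (i : 'I_n) : nth 0%N (permword l (tperm r r' * pi)%g 0%N) i =
    nth 0%N (permword l pi 0%N) (tperm r r' i).
  by rewrite !nth_permword permM.
have [wE w'E] := adjacent_wordE rr' (size_permword l pi 0%N) (size_permword _ _ _) ww'.
rewrite addbA; congr (_ (+) _); rewrite {1}w'E [in RHS]wE oddinv_adjacent.
  by rewrite !nth_permword !ap andbC.
rewrite !nth_permword nth_uniq ?sl // val_eqE (inj_eq perm_inj) -val_eqE /= rr'.
by rewrite neq_ltn ltnSn orbT.
Qed.

(* If some argument is 0 its parity is not determined, but then all terms vanish. *)
Lemma bracket_words T epsT n (a : n.-tuple A) (f : nat -> letter) l :
  T 0 = 0 -> uniq l -> a = [seq (f x).1 | x <- l] :> seq A ->
  {in l, forall x, homletter (f x)} ->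
  koszul_bracket e T epsT a =
  \sum_(v <- permutations l)
    (-1) ^+ (oddinv (fun x => (f x).2) v (+) oddinv (fun x => (f x).2) l) *:
      psi e T epsT (map f v).
Proof.
move=> T0 ul aE hl; set p := fun x => (f x).2.
have sl : size l = n by rewrite -(size_map (fun x => (f x).1)) -aE size_tuple.
have aP (r : 'I_n) : tnth a r = (f (nth 0%N l r)).1.
  by rewrite (tnth_nth 0) aE (nth_map 0%N) // sl.
rewrite -(sum_permword 0%N _ ul sl) /koszul_bracket.
transitivity (\sum_(pi : 'S_n) \sum_(i < n.+1) \sum_(j < n.+1)
   \sum_(k < n.+1 | (i + j + k)%N == n)
    (koszul_number F i k / (i`! * j`! * k`!)%:R) *:
    ((-1) ^+ (koszul_sign a pi
        + epsT * (\sum_(x <- take i (permuted a pi)) parity x + i * eps))%N *: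
     term T (map f (permword l pi 0%N)) i j)).
  rewrite [RHS]exchange_big; apply: eq_bigr => i _.
  rewrite [RHS]exchange_big; apply: eq_bigr => j _.
  rewrite [RHS]exchange_big; apply: eq_bigr => k _.
  rewrite scaler_sumr; apply: eq_bigr => pi _; do 2 congr (_ *: _).
  suff wE : permuted a pi = map fst (map f (permword l pi 0%N)) :> seq A.
    by rewrite wE /term /lract /lact /ract !map_take !map_drop.
  by rewrite /permuted /= -!map_comp; apply: eq_map => r /=; rewrite aP.
apply: eq_bigr => pi _; set w := permword l pi 0%N.
have sw : size (map f w) = n by rewrite size_map size_permword.
have wl : perm_eq w l := perm_permword pi 0%N ul sl.
rewrite (psi_ord _ _ sw) !scaler_sumr; apply: eq_bigr => i _.
rewrite !scaler_sumr; apply: eq_bigr => j _.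
rewrite !scaler_sumr; apply: eq_bigr => k _.
have [w0|w_neq0] := boolP (0 \in map fst (map f w)).
  by rewrite (term_zero _ _ T0 w0) !scaler0.
move: (koszul_number F i k / _) => c.
rewrite !scalerA; congr (_ *: _); rewrite [_ * c]mulrC -mulrA; congr (_ * _).
have hpar x : x \in l -> parity (f x).1 (+) eps = (f x).2.
  move=> xl; apply: homletter_parity; first exact: hl.
  apply: contraNneq w_neq0 => <-; rewrite -map_comp.
  by apply/mapP; exists x; rewrite ?(perm_mem wl).
rewrite (koszul_sign_inv (p := p) pi ul sl) => [|r]; last first.
  by rewrite aP hpar // mem_nth ?sl.
rewrite exprD; congr (_ * _).
rewrite -signr_odd oddM oddb; congr (_ ^+ (_ && _)).
have -> : (\sum_(x <- take i (permuted a pi)) parity x =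
    \sum_(x <- map fst (take i (map f w))) parity x)%N.
  congr bigop; rewrite map_take; congr take.
  by rewrite /permuted /= -!map_comp; apply: eq_map => r /=; rewrite aP.
have {2}-> : nat_of_ord i = size (take i (map f w)).
  by rewrite size_takel // sw; have := ltn_ord i.
apply: odd_sum_parity => b /mem_take /mapP[x xw ->]; apply: hpar.
by rewrite -(perm_mem wl).
Qed.

Lemma gpart_add q (m m' : A) :
  m \in gpart A q -> m' \in gpart A q -> m + m' \in gpart A q.
Proof.
by move=> mq m'q; have [_ /(_ 1 m m' mq m'q)] := gpart_submod A q; rewrite scale1r.
Qed.

Lemma gpart_scale q k (m : A) : m \in gpart A q -> k *: m \in gpart A q.
Proof. by move=> mq; have [m0 /(_ k m 0 mq m0)] := gpart_submod A q; rewrite addr0. Qed.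

Lemma cut_gpart q w (G : seq letter -> seq letter -> A) :
  (forall u v, u ++ v = w -> G u v \in gpart A q) -> cut w G \in gpart A q.
Proof.
elim: w G => [|a w IHw] G GP /=; first exact: GP.
apply: gpart_add; first exact: GP.
by apply: IHw => u v uv; apply: GP; rewrite /= uv.
Qed.

(** In suspended parities the product is even. *)
Lemma addb_shift b b' c : b (+) c (+) (b' (+) c) (+) c = b (+) b' (+) c.
Proof. by case: b b' c => [] [] []. Qed.

Lemma lact_gpart u q m : (forall a, a \in u -> homletter a) ->
  m \in gpart A (q (+) eps) -> lact u m \in gpart A (wpar u (+) q (+) eps).
Proof.
move=> + mq; elim: u => [|a u IHu] hu; first by rewrite /wpar big_nil.
rewrite -[lact _ _]/(gmul A a.1 (lact u m)).
have := gmul_parity (hu a (mem_head _ _))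
  (IHu (fun b bu => hu b (@mem_behead _ (a :: u) b bu))).
by rewrite addb_shift wpar_cons !addbA.
Qed.

Lemma ract_gpart s q m : (forall a, a \in s -> homletter a) ->
  m \in gpart A (q (+) eps) -> ract m s \in gpart A (q (+) wpar s (+) eps).
Proof.
elim: s q m => [|a s IHs] q m hs mq; first by rewrite /wpar big_nil addbF.
rewrite -[ract _ _]/(ract (gmul A m a.1) s).
rewrite wpar_cons addbA; apply: IHs => [b bs|]; first by apply: hs; rewrite inE bs orbT.
by rewrite -addb_shift; apply: gmul_parity mq (hs a (mem_head _ _)).
Qed.

(** Since [e] has suspended parity 0, only the odd [T] shifts the parity; so the parity declared for
    the new letter in [comp_psi] is its true one. *)
Lemma psi_gpart T w : e \in gpart A eps -> operator_parity T true ->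
  (forall a, a \in w -> homletter a) ->
  psi e T true w \in gpart A (~~ wpar w (+) eps).
Proof.
move=> he hT hw; apply: cut_gpart => u r ur; apply: cut_gpart => v s vs.
have {hw}hw a : (a \in u) || (a \in v) || (a \in s) -> homletter a.
  by move=> aw; apply: hw; rewrite -ur -vs !mem_cat orbA.
apply: gpart_scale; rewrite /core linearZ; apply: gpart_scale; rewrite /lract.
have hv : lact v e \in gpart A (wpar v (+) false (+) eps).
  by apply: lact_gpart => // a av; apply: hw; rewrite av orbT.
have {hv}hv : T (lact v e) \in gpart A (~~ wpar v (+) eps).
  by have := hT _ _ hv; rewrite addbF addbAC addbT.
have -> : ~~ wpar w = wpar u (+) ~~ wpar v (+) wpar s.
  by rewrite -ur -vs !wpar_cat; case: (wpar u) (wpar v) (wpar s) => [] [] [].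
apply: ract_gpart => [a as_|]; first by apply: hw; rewrite as_ orbT.
by apply: lact_gpart => // a au; apply: hw; rewrite au.
Qed.

Lemma cut_linear w (G : A -> seq letter -> seq letter -> A) :
  (forall u v, linear (fun c => G c u v)) -> linear (fun c => cut w (G c)).
Proof.
move=> GP k c c'; rewrite (cut_morph (f := *:%R k)); last exact: scalerDr.
by rewrite -cutD; apply: eq_cut => u v _; rewrite GP.
Qed.

(** Linearity holds because the parity [q] is declared, and so stays fixed while the element [c]
    varies. *)
Lemma psi_letter_linear (T : {linear A -> A}) epsT x q z :
  linear (fun c => psi e T epsT (x ++ (c, q) :: z)).
Proof.
pose B := if epsT then twist (@beta letter F) else @beta letter F.
(* Coefficients and signs see only lengths and declared parities, so they do not change when [c] is
   replaced by [0]. *)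
have BE c u s : (B (x ++ (c, q) :: u) s = B (x ++ (0, q) :: u) s)
    * (B u (s ++ (c, q) :: z) = B u (s ++ (0, q) :: z)).
  rewrite /B; case: (epsT); rewrite /twist /beta ?wsign_cat ?wsign_cons !size_cat //.
pose G1 c := cut3 x (fun u v s =>
  B u (s ++ (0, q) :: z) *: ract (gmul A (lract u s (core e T v)) c) z).
pose G2 c := cut x (fun u v => cut z (fun v' s => B u s *:
  lract u s ((size v + size v').+1`!%:R^-1 *: T (lact v (gmul A c (lact v' e)))))).
pose G3 c := cut3 z (fun u v s =>
  B (x ++ (0, q) :: u) s *: lact x (gmul A c (lract u s (core e T v)))).
have E c : psi e T epsT (x ++ (c, q) :: z) = G1 c + G2 c + G3 c.
  rewrite /psi /app cut3_cat_cons -/B; congr (_ + _ + _).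
  - by apply: eq_cut3 => u v s _; rewrite BE lract_cat_consr.
  - apply: eq_cut => u v _; apply: eq_cut => v' s _.
    by rewrite /core size_cat /= addnS lact_cat.
  - by apply: eq_cut3 => u v s _; rewrite BE lract_cat_consl.
have ZP r (f : A -> A) : linear f -> linear (fun c => r *: f c).
  by move=> fP k c c'; rewrite fP scalerDr !scalerA mulrC.
have P1 : linear G1.
  apply: cut_linear => u r; apply: cut_linear => v s; apply: (ZP) => k c c'.
  by rewrite linearPr ract_is_linear.
have P2 : linear G2.
  apply: cut_linear => u v; apply: cut_linear => v' s; apply: (ZP) => k c c'.
  by rewrite linearPl 2!linearP (ZP _ id) //= linearP.
have P3 : linear G3.
  apply: cut_linear => u r; apply: cut_linear => v s; apply: (ZP) => k c c'.
  by rewrite linearPl linearP.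
move=> k c c'; rewrite !E P1 P2 P3 !scalerDr.
by rewrite (addrACA (k *: G1 c)) [LHS]addrACA.
Qed.

(** The sum in the first slot is treated as one letter with a fresh label [N] above all others;
    moving it behind [x] costs only the parity of [x] times [q]. Linearity in this letter then
    splits the sum. *)
Lemma bracket_insert (T : {linear A -> A}) epsT n (a : n.-tuple A) (f : nat -> letter)
    (N : nat) l (I : eqType) (r : seq I) (k : I -> F) (c : I -> A) q :
  uniq l -> (forall x, x \in l -> (x < N)%N) ->
  (forall x, x \in l -> homletter (f x)) ->
  (forall i, i \in r -> c i \in gpart A (q (+) eps)) ->
  a = \sum_(i <- r) k i *: c i :: [seq (f x).1 | x <- l] :> seq A ->
  koszul_bracket e T epsT a =
  \sum_(i <- r) k i *: \sum_(v <- permutations l)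
    (-1) ^+ (oddinv (fun x => (f x).2) v (+) oddinv (fun x => (f x).2) l) *:
    cut v (fun x z => (-1) ^+ (q && odd_par (fun x => (f x).2) x) *:
      psi e T epsT (map f x ++ (c i, q) :: map f z)).
Proof.
move=> ul ltN hl hc aE; pose C := \sum_(i <- r) k i *: c i.
pose f' x := if x == N then (C, q) else f x.
have f'N : f' N = (C, q) by rewrite /f' eqxx.
have f'E x : x \in l -> f' x = f x.
  by move=> xl; rewrite /f' ltn_eqF ?ltN.
have Nl : N \notin l by apply/negP => /ltN; rewrite ltnn.
have mapf' (u : seq nat) : {subset u <= l} -> map f' u = map f u.
  by move=> ul'; apply/eq_in_map => x /ul'; apply: f'E.
have uNl : uniq (N :: l) by rewrite /= Nl.
have Cq : C \in gpart A (q (+) eps).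
  rewrite /C big_seq; elim/big_rec: _ => [|i m ir mP].
    by have [] := gpart_submod A (q (+) eps).
  by apply: gpart_add mP; apply: gpart_scale; apply: hc.
rewrite (bracket_words epsT (f := f') (l := N :: l)) ?linear0 //; last first.
- move=> x; rewrite inE => /orP[/eqP ->|xl]; last by rewrite f'E // hl.
  by rewrite /homletter f'N.
- rewrite aE /= f'N; congr (_ :: _).
  by rewrite (map_comp fst) -mapf' // -map_comp.
rewrite sum_permutations_cons //.
under [RHS]eq_bigr => i _ do rewrite scaler_sumr.
rewrite [RHS]exchange_big; apply: eq_big_seq => v; rewrite mem_permutations => vl.
transitivity ((-1) ^+ (oddinv (fun x => (f x).2) v (+) oddinv (fun x => (f x).2) l) *:
   cut v (fun x z => (-1) ^+ (q && odd_par (fun x => (f x).2) x) *: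
      psi e T epsT (map f x ++ (C, q) :: map f z))).
  rewrite (cut_morph (f := *:%R _)); last exact: scalerDr.
  apply: eq_cut => x z xz; have xl b : b \in x ++ z -> b \in l by rewrite xz (perm_mem vl).
  rewrite scalerA -signr_addb map_cat /= f'N !mapf'; last 2 first.
  - by move=> b bz; rewrite xl // mem_cat bz orbT.
  - by move=> b bx; rewrite xl // mem_cat bx.
  congr (_ ^+ _ *: _).
  have p'E (u : seq nat) : {subset u <= l} ->
      (oddinv (fun x => (f' x).2) u = oddinv (fun x => (f x).2) u) *
      (odd_par (fun x => (f' x).2) u = odd_par (fun x => (f x).2) u).
    by move=> ul'; split; [apply: eq_oddinv|apply: eq_odd_par] => b /ul' /f'E ->.
  have := @oddinv_insert_max (fun x => (f' x).2) N x z (fun b bxz => ltN b (xl b bxz)).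
  have xsub : {subset x <= l} by move=> b bx; rewrite xl // mem_cat bx.
  rewrite f'N /= (p'E x xsub).2 => <-.
  have xzl : {subset x ++ z <= l} by [].
  (* The inversions of [N] placed in front do not depend on the order of the other labels. *)
  have crossE : cross (fun x => (f' x).2) [:: N] (x ++ z) =
      cross (fun x => (f' x).2) [:: N] l.
    by apply: perm_cross; rewrite // xz.
  rewrite crossE (p'E _ xzl).1 (p'E l (fun _ => id)).1 xz.
  by move: (oddinv _ (_ ++ _)) (oddinv _ v) (cross _ _ _) (oddinv _ l) => [] [] [] [].
under [RHS]eq_bigr => i _ do [rewrite scalerA mulrC -scalerA].
rewrite -scaler_sumr; congr (_ *: _).
have cutL : linear (fun C => cut v (fun x z =>
    (-1) ^+ (q && odd_par (fun x => (f x).2) x) *: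
      psi e T epsT (map f x ++ (C, q) :: map f z))).
  move=> k' m m'; rewrite (cut_morph (f := *:%R k')); last exact: scalerDr.
  rewrite -cutD; apply: eq_cut => x z _.
  by rewrite psi_letter_linear scalerDr !scalerA [k' * _]mulrC.
exact: (linear_sum_scale r k c cutL).
Qed.

Lemma odd_parE (f : nat -> letter) l : odd_par (fun x => (f x).2) l = wpar (map f l).
Proof. by rewrite /odd_par /wpar big_map. Qed.

(** Both brackets become sums over orderings: of the inner arguments, and of the outer ones with the
    inner bracket inserted. The orderings inside the two blocks are absorbed into that of all
    arguments, and a block exchange puts the inner arguments where the new letter stands. *)
Lemma comp_psi_symmetrized (T : {linear A -> A}) n (a : n.-tuple A) (f : nat -> letter) l :
  e \in gpart A eps -> operator_parity T true ->
  uniq l -> a = [seq (f x).1 | x <- l] :> seq A ->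
  (forall x, x \in l -> homletter (f x)) ->
  (forall r : 'I_n, parity (tnth a r) (+) eps = (f (nth 0%N l r)).2) ->
  bracket_comp (koszul_bracket e T true) (koszul_bracket e T true) a =
  \sum_(v <- permutations l)
    (-1) ^+ (oddinv (fun x => (f x).2) v (+) oddinv (fun x => (f x).2) l) *:
      comp_psi e T T (map f v).
Proof.
move=> he hT ul aE hl apar; set p := fun x => (f x).2.
have sl : size l = n by rewrite -(size_map (fun x => (f x).1)) -aE size_tuple.
have aP (r : 'I_n) : tnth a r = (f (nth 0%N l r)).1.
  by rewrite (tnth_nth 0) aE (nth_map 0%N) // sl.
have [N ltN] : exists N, forall x, x \in l -> (x < N)%N.
  by exists (\sum_(x <- l) x).+1 => x xl; rewrite ltnS (big_rem x) //= leq_addr.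
(* The inner operation on [y] is inserted at every place of [z]; the sign is that of moving it from
   the front past [x]. *)
pose ins y z := cut z (fun x z' => (-1) ^+ (~~ wpar (map f y) && wpar (map f x)) *:
  psi e T true (map f x ++ (psi e T true (map f y), ~~ wpar (map f y)) :: map f z')).
have ksE (k : 'I_n.+1) (w : seq nat) (b : n.-tuple A) : perm_eq w l ->
    b = [seq (f x).1 | x <- w] :> seq A ->
    koszul_bracket e T true
      [tuple of koszul_bracket e T true [tuple of take k b] :: drop k b] =
    \sum_(y <- permutations (take k w)) \sum_(z <- permutations (drop k w))
      (-1) ^+ (oddinv p y (+) oddinv p (take k w)
        (+) (oddinv p z (+) oddinv p (drop k w))) *: ins y z.
  move=> wl bE; have uw : uniq w by rewrite (perm_uniq wl).
  have hw x : x \in w -> homletter (f x) by rewrite (perm_mem wl); apply: hl.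
  set c := koszul_bracket e T true [tuple of take k b].
  have cE : c = \sum_(y <- permutations (take k w))
      (-1) ^+ (oddinv p y (+) oddinv p (take k w)) *: psi e T true (map f y).
    apply: bracket_words; rewrite ?linear0 ?take_uniq //=; first by rewrite bE map_take.
    by move=> x /mem_take; apply: hw.
  rewrite (@bracket_insert T true _ _ f N (drop k w) _ (permutations (take k w))
    (fun y => (-1) ^+ (oddinv p y (+) oddinv p (take k w)))
    (fun y => psi e T true (map f y)) (~~ wpar (map f (take k w)))).
  - apply: eq_big_seq => y; rewrite mem_permutations => yk.
    rewrite scaler_sumr; apply: eq_bigr => z _.
    rewrite scalerA -signr_addb; congr (_ *: _); apply: eq_cut => x z' _.
    rewrite odd_parE; suff -> : wpar (map f (take k w)) = wpar (map f y) by [].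
    by rewrite /wpar; apply: perm_big; rewrite perm_sym perm_map.
  - by rewrite drop_uniq.
  - by move=> x /mem_drop; rewrite (perm_mem wl); apply: ltN.
  - by move=> x /mem_drop; apply: hw.
  - move=> y; rewrite mem_permutations => yk.
    suff -> : wpar (map f (take k w)) = wpar (map f y).
      apply: psi_gpart => // _ /mapP[x xy ->]; apply: hw.
      by move: xy; rewrite (perm_mem yk) => /mem_take.
    by rewrite /wpar; apply: perm_big; rewrite perm_sym perm_map.
  - by rewrite -cE map_drop -bE.
(* The signs of [pi] and of both inner orderings combine to that of [y ++ z], because [cross] is
   unchanged by rearranging inside the blocks. *)
transitivity (\sum_(k < n.+1) (k`! * (n - k)`!)%:R^-1 *: \sum_(w <- permutations l)
   \sum_(y <- permutations (take k w)) \sum_(z <- permutations (drop k w))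
     (-1) ^+ (oddinv p (y ++ z) (+) oddinv p l) *: ins y z).
  apply: eq_bigr => k _; congr (_ *: _); rewrite -(sum_permword 0%N _ ul sl).
  apply: eq_bigr => pi _; set w := permword l pi 0%N.
  have wl : perm_eq w l := perm_permword pi 0%N ul sl.
  have bE : permuted a pi = [seq (f x).1 | x <- w] :> seq A.
    by rewrite /w /permword -map_comp /permuted /=; apply: eq_map => r /=; rewrite aP.
  cbv zeta; rewrite (ksE _ _ _ wl bE) (koszul_sign_inv (p := p) pi ul sl) => [|r]; last first.
    by rewrite apar.
  rewrite scaler_sumr; apply: eq_big_seq => y; rewrite mem_permutations => yk.
  rewrite scaler_sumr; apply: eq_big_seq => z; rewrite mem_permutations => zk.
  rewrite scalerA -signr_addb; congr (_ ^+ _ *: _).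
  rewrite -/w -{1}[w](cat_take_drop k) !oddinv_cat (perm_cross p yk zk).
  move: (oddinv p y) (oddinv p z) (oddinv p (take _ _)) (oddinv p (drop _ _)).
  by move: (oddinv p l) (cross _ _ _) => [] [] [] [] [] [].
transitivity (\sum_(w <- permutations l) (-1) ^+ (oddinv p w (+) oddinv p l) *:
   \sum_(k < n.+1) ins (take k w) (drop k w)).
  under [RHS]eq_bigr => w _ do rewrite scaler_sumr.
  rewrite [RHS]exchange_big; apply: eq_bigr => k _.
  have kn : (k <= n)%N by rewrite -ltnS.
  rewrite (sum_permutations_take_drop
    (fun y z => (-1) ^+ (oddinv p (y ++ z) (+) oddinv p l) *: ins y z)) ?sl //.
  rewrite -scaler_nat scalerA mulVf ?scale1r; last first.
    by rewrite nat_neq0 // muln_gt0 !fact_gt0.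
  by apply: eq_bigr => w _; rewrite cat_take_drop.
pose K x y z :=
  psi e T true (map f x ++ (psi e T true (map f y), ~~ wpar (map f y)) :: map f z).
transitivity (\sum_(w <- permutations l) cut3 w (fun y x z =>
  (-1) ^+ (oddinv p (y ++ x ++ z) (+) oddinv p l (+) (~~ wpar (map f y) && wpar (map f x)))
   *: K x y z)).
  apply: eq_big_seq => w; rewrite mem_permutations => /perm_size; rewrite sl => sw.
  rewrite -sw -cut_ord (cut_morph (f := *:%R _)); last exact: scalerDr.
  apply: eq_cut => y r yr; rewrite (cut_morph (f := *:%R _)); last exact: scalerDr.
  by apply: eq_cut => x z xz; rewrite scalerA -signr_addb xz yr.
(* The word [y ++ x ++ z] is reordered to [x ++ y ++ z]. The exchange contributes
   [wpar x && wpar y], which together with [~~ wpar y && wpar x] is the exponent of [wsign x]. *)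
rewrite sum_cut3_swap //; apply: eq_big_seq => w; rewrite mem_permutations => wl.
rewrite /comp_psi cut3_map (cut3_morph (f := *:%R _)); last exact: scalerDr.
apply: eq_cut3 => x y z xyz; rewrite /wsign scalerA -signr_addb; congr (_ ^+ _ *: _).
have := @cross_swap p x y; rewrite !odd_parE => xy.
have {xy} : cross p x y (+) cross p y x = wpar (map f x) && wpar (map f y).
  apply: xy => b c bx cy; apply/eqP => bc.
  have : uniq w by rewrite (perm_uniq wl).
  rewrite -xyz cat_uniq => /and3P[_ /hasPn/(_ c)]; rewrite mem_cat cy -bc bx.
  by move=> /(_ isT).
rewrite -xyz !oddinv_cat !cross_catr.
move: (cross p x y) (cross p y x) (wpar (map f x)) (wpar (map f y)) (cross p x z) (cross p y z).
move: (oddinv p x) (oddinv p y) (oddinv p z) (oddinv p l).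
by move=> [] [] [] [] [] [] [] [] [] [].
Qed.

End Symmetrization.

Theorem theorem3p6 (R : realType) (eps : bool) (A : gradedAlgebra R[i] eps)
    (e : A) (Delta : {linear A -> A})
    (he : e \in gpart A eps) (hDelta : operator_parity Delta true)
    (n : nat) (a : n.-tuple A) (ha : forall r : 'I_n, homogeneous (tnth a r)) :
  bracket_comp (koszul_bracket e Delta true) (koszul_bracket e Delta true) a =
  koszul_bracket e (Delta \o rmul e \o Delta) false a.
Proof.
pose f i := (nth 0 a i, parity (nth 0 a i) (+) eps).
have ul := iota_uniq 0 n.
have aE : a = [seq (f x).1 | x <- iota 0 n] :> seq A.
  by rewrite -[LHS](mkseq_nth 0) size_tuple.
have hl x : x \in iota 0 n -> homletter (f x).
  rewrite mem_iota add0n => /= xn; rewrite /homletter /f /= -addbA addbb addbF.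
  have [q] := ha (Ordinal xn); rewrite (tnth_nth 0) /= /parity => xq.
  (* If the element is not in the odd part, homogeneity places it in the even part; [0] counts as
     odd here. *)
  case x1: (nth 0 a x \in gpart A true) => //.
  by case: q xq => //; rewrite x1.
rewrite (comp_psi_symmetrized he hDelta ul aE hl) => [|r]; last first.
  by rewrite nth_iota // add0n (tnth_nth 0).
rewrite (@bracket_words _ _ _ e (Delta \o rmul e \o Delta) false _ a f _ _ ul aE hl);
  last first.
  by rewrite /= /rmul linear0 gmul0x linear0.
by apply: eq_bigr => v _; rewrite comp_psiE.
Qed.
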